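(* Fix $h\in(0,1]$ and $\Delta t>0$ and consider the Galerkin Euler--Maruyama scheme $$X_h^{j+1}=D^{\mathrm{det}}X_h^j+r_{\mathrm d}^{-1}(\Delta tA_h)P_hG(X_h^j)\Delta L^j,\quad j\in\mathbb{N}_0,\qquad X_h^0=P_hX_0,$$ where $D^{\mathrm{det}}=R(\Delta tA_h)+r_{\mathrm d}^{-1}(\Delta tA_h)\,\Delta t\,P_hF\in L(V_h)$. The zero solution of this scheme is asymptotically mean-square stable if and only if $$\mathcal{S}=D^{\mathrm{det}}\otimes D^{\mathrm{det}}+\Delta t\,(C\otimes C)q\in L(V_h^{(2)})$$ satisfies $\rho(\mathcal{S})<1$, where $\rho$ denotes the spectral radius, $q=\sum_{k=1}^\infty\mu_k\,f_k\otimes f_k\in U^{(2)}$ and $C\in L(U;L(V_h))$ is given by $Cu=r_{\mathrm d}^{-1}(\Delta tA_h)P_hG(\cdot)u$ for $u\in U$.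
   Context: $(\Omega,\mathcal{A},(\mathcal{F}_t)_{t\ge0},P)$ is a complete filtered probability space satisfying the usual conditions; $H$ and $U$ are real separable Hilbert spaces. $-A:\mathcal{D}(-A)\subset H\to H$ is densely defined, self-adjoint and positive definite with compact inverse; $F\in L(H)$; $G\in L(H;L(U;H))$, i.e. $G$ is bounded and linear from $H$ to the bounded linear operators $U\to H$. $X_0\in L^2(\Omega;H)$ is $\mathcal{F}_0$-measurable. $L$ is a $U$-valued square-integrable $Q$-L\'evy process with respect to $(\mathcal{F}_t)$ (adapted, $L(t)-L(s)$ independent of $\mathcal{F}_s$ for $s<t$) that is a martingale; its covariance operator $Q\in L(U)$ is self-adjoint, positive semidefinite and of trace class, with orthonormal eigenbasis $(f_k,k\in\mathbb{N})$ of $U$ and eigenvalues $\mu_1\ge\mu_2\ge\dots\ge0$, $Qf_k=\mu_kf_k$. $t_j=j\Delta t$ and $\Delta L^j=L(t_{j+1})-L(t_j)$. $\dot H^1=\mathcal{D}((-A)^{1/2})$ with inner product $\langle\cdot,\cdot\rangle_1=\langle(-A)^{1/2}\cdot,(-A)^{1/2}\cdot\rangle_H$. $V_h\subset\dot H^1\subset H$ is a subspace of finite dimension $N_h$, with the norm of $H$; $P_h$ is the $H$-orthogonal projection onto $V_h$; $-A_h:V_h\to V_h$ is defined by $\langle-A_hv,w\rangle_H=\langle v,w\rangle_1$ for all $v,w\in V_h$. It is self-adjoint and positive definite, with eigenvalues $0<\lambda_{h,1}\le\dots\le\lambda_{h,N_h}$ and corresponding $H$-orthonormal eigenvectors $e_{h,1},\dots,e_{h,N_h}$.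 $R=r_{\mathrm n}/r_{\mathrm d}$ ($r_{\mathrm n},r_{\mathrm d}$ polynomials) is a rational approximation of some order $p$ of the exponential function, i.e. there are constants $c,\delta>0$ with $|R(z)-\exp(z)|\le c|z|^{p+1}$ for all $z\in\mathbb{C}$, $|z|<\delta$; it is assumed that $r_{\mathrm d}(-\Delta t\lambda_{h,k})\ne0$ for $k=1,\dots,N_h$, and $$R(\Delta tA_h)v=\sum_{k=1}^{N_h}\frac{r_{\mathrm n}(-\Delta t\lambda_{h,k})}{r_{\mathrm d}(-\Delta t\lambda_{h,k})}\langle v,e_{h,k}\rangle_He_{h,k},\qquad r_{\mathrm d}^{-1}(\Delta tA_h)v=\sum_{k=1}^{N_h}\frac{1}{r_{\mathrm d}(-\Delta t\lambda_{h,k})}\langle v,e_{h,k}\rangle_He_{h,k}.$$ For a Hilbert space $K$, $K^{(2)}=K\otimes K$ is the Hilbert tensor product; for $D_1,D_2\in L(V_h)$, $D_1\otimes D_2\in L(V_h^{(2)})$ satisfies $(D_1\otimes D_2)(v\otimes w)=D_1v\otimes D_2w$. $C\otimes C$ is the bounded linear map $U^{(2)}\to L(V_h^{(2)})$ with $(C\otimes C)(u_1\otimes u_2)=(Cu_1)\otimes(Cu_2)$, and $(Cu)v=r_{\mathrm d}^{-1}(\Delta tA_h)P_hG(v)u$ for $v\in V_h$. The zero solution of the scheme is $X_{h,\mathrm e}^j=0$ for all $j$. It is mean-square stable if for every $\varepsilon>0$ there is $\delta>0$ such that $\mathbb{E}[\|X_h^j\|_H^2]<\varepsilon$ for all $j\in\mathbb{N}_0$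 whenever ($X_h^0\in L^2(\Omega;V_h)$ is $\mathcal{F}_0$-measurable and) $\mathbb{E}[\|X_h^0\|_H^2]<\delta$. It is asymptotically mean-square stable if it is mean-square stable and there is $\delta>0$ such that $\mathbb{E}[\|X_h^0\|_H^2]<\delta$ implies $\lim_{j\to\infty}\mathbb{E}[\|X_h^j\|_H^2]=0$. *)

(* Defs.v *)
From HB Require Import structures.
From mathcomp Require Import all_boot all_order all_algebra.
From mathcomp Require Export complex.
From mathcomp Require Import all_classical all_reals all_analysis.

Set Implicit Arguments.
Unset Strict Implicit.
Unset Printing Implicit Defensive.

Import Order.TTheory GRing.Theory Num.Theory.
Import numFieldNormedType.Exports.

Local Open Scope classical_set_scope.
Local Open Scope ring_scope.

HB.mixin Record CompleteNormedModule_isHilbert (R : realType) H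
    of CompleteNormedModule R H := {
  inner : H -> H -> R;
  innerC : forall x y, inner x y = inner y x;
  inner_linearl : forall (a : R) x y z,
    inner (a *: x + y) z = a * inner x z + inner y z;
  inner_norm : forall x, inner x x = `|x| ^+ 2
}.

#[short(type="hilbertType")]
HB.structure Definition Hilbert (R : realType) :=
  {H of CompleteNormedModule_isHilbert R H & CompleteNormedModule R H}.

Notation "''[' x , y ]" := (inner x y) : ring_scope.

Section HilbertSpaces.
Context {R : realType}.

Definition separable (H : hilbertType R) := exists2 S : set H, countable S & dense S.

Definition bounded_bilinear (H K M : hilbertType R) (b : H -> K -> M) :=
  exists c : R, forall x y, `|b x y| <= c * `|x| * `|y|.

Definition orthonormal_seq I (H : hilbertType R) (e : I -> H) :=
  forall i j, '[e i, e j] = `[< i = j >]%:R.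

Definition orthonormal_basis (H : hilbertType R) (f : nat -> H) :=
  orthonormal_seq f /\
  forall x, series (fun k => '[x, f k] *: f k) @ \oo --> x.

Definition fin_orthonormal_basis (H : hilbertType R) n (e : 'I_n -> H) :=
  orthonormal_seq e /\ forall x, x = \sum_k '[x, e k] *: e k.

Record unbounded_op (H : hilbertType R) := UnboundedOp {
  dom : set H;
  op_fun :> H -> H;
  dom0 : dom 0;
  op_linear : forall (a : R) x y, dom x -> dom y ->
    dom (a *: x + y) /\ op_fun (a *: x + y) = a *: op_fun x + op_fun y
}.

Section Unbounded.
Variable H : hilbertType R.
Implicit Types B S : unbounded_op H.

(* The second clause says that the domain of the adjoint is contained in the
   domain of [B]. *)
Definition selfadjoint B :=
  [/\ dense (dom B),
      forall x y, dom B x -> dom B y -> '[B x, y] = '[x, B y] &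
      forall y z, (forall x, dom B x -> '[B x, y] = '[x, z]) -> dom B y].

Definition op_nonneg B := forall x, dom B x -> 0 <= '[B x, x].

Definition op_posdef B := forall x, dom B x -> x != 0 -> 0 < '[B x, x].

Definition compact_inverse B := exists K : {linear H -> H},
  [/\ forall x, dom B x -> K (B x) = x,
      forall y, dom B (K y) /\ B (K y) = y &
      precompact (K @` [set x | `|x| <= 1])].

(* [S] is B^(1/2), the unique nonnegative self-adjoint square root of [B]. *)
Definition is_sqrt_op B S :=
  [/\ selfadjoint S, op_nonneg S,
      forall x, dom B x <-> dom S x /\ dom S (S x) &
      forall x, dom B x -> S (S x) = B x].

End Unbounded.

(* [K2], equipped with [t : (v, w) |-> v (x) w], is the Hilbert tensor product
   of [K] with itself; this determines it up to a unique isometry. *)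
Definition hilbert_tensor (K K2 : hilbertType R) (t : {bilinear K -> K -> K2}) :=
  (forall a b c d, '[t a b, t c d] = '[a, c] * '[b, d]) /\
  dense [set x | exists n (a b : 'I_n -> K), x = \sum_i t (a i) (b i)].

Definition is_tensor_op (K K2 : hilbertType R) (t : K -> K -> K2)
    (D1 D2 : K -> K) (T : K2 -> K2) :=
  forall v w, T (t v w) = t (D1 v) (D2 w).

(* [p] stands for p.1 + i p.2 in the complexification of [K], and this is
   p |-> (S - z) p there. *)
Definition complexified_shift (K : hilbertType R) (S : K -> K) (z : R[i])
    (p : K * K) : K * K :=
  (S p.1 - (complex.Re z *: p.1 - complex.Im z *: p.2),
   S p.2 - (complex.Im z *: p.1 + complex.Re z *: p.2)).

Definition spectrum (K : hilbertType R) (S : K -> K) : set R[i] :=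
  [set z | ~ bijective (complexified_shift S z)].

Definition spectral_radius (K : hilbertType R) (S : K -> K) : R :=
  sup [set ComplexField.Normc.normc z | z in spectrum S].

End HilbertSpaces.

Section Probability.
Context {R : realType} {d : measure_display} {T : measurableType d}.
Variable P : probability T R.

Definition rv_wrt (H : hilbertType R) (G : set (set T)) (X : T -> H) :=
  forall B, <<s @open H >> B -> G (X @^-1` B).

Definition square_integrable (H : hilbertType R) (X : T -> H) :=
  rv_wrt measurable X /\ ('E_P[fun w => (`|X w| ^+ 2)%R] < +oo)%E.

Definition simple_rv (H : hilbertType R) (s : T -> H) :=
  finite_set (range s) /\ forall x, measurable (s @^-1` [set x]).

Definition simple_integral (H : hilbertType R) (A : set T) (s : T -> H) : H :=
  \sum_(x \in range s) fine (P (A `&` s @^-1` [set x])) *: x.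

(* [X] is Bochner integrable over [A], with integral [v]. *)
Definition bochner_integral (H : hilbertType R) (A : set T) (X : T -> H) (v : H) :=
  exists s : nat -> T -> H,
  [/\ forall n, simple_rv (s n),
      (\int[P]_(w in A) (`|X w - s n w|)%:E)%E @[n --> \oo] --> 0%E &
      simple_integral A (s n) @[n --> \oo] --> v].

(* [Y] is a version of E[X | G]. *)
Definition cond_expectation (H : hilbertType R) (G : set (set T)) (X Y : T -> H) :=
  rv_wrt G Y /\
  forall A, G A -> exists2 v, bochner_integral A X v & bochner_integral A Y v.

(* Filtrations and processes are indexed by [R]; only times t >= 0 matter. *)
Record filtration_usual (F : R -> set (set T)) : Prop := {
  filtration_sigma : forall t : R, 0 <= t -> sigma_algebra [set: T] (F t);
  filtration_sub : forall t : R, 0 <= t -> F t `<=` measurable;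
  filtration_incr : forall s t : R, 0 <= s -> s <= t -> F s `<=` F t;
  filtration_right : forall t : R, 0 <= t -> \bigcap_(s in [set s | t < s]) F s `<=` F t;
  filtration_null : forall N, P.-negligible N -> F 0 N
}.

Definition increment (U : hilbertType R) (L : R -> T -> U) (s t : R) (w : T) : U :=
  L t w - L s w.

Record Levy_process (U : hilbertType R) (F : R -> set (set T)) (L : R -> T -> U)
    : Prop := {
  Levy_adapted : forall t : R, 0 <= t -> rv_wrt (F t) (L t);
  Levy_0 : {ae P, forall w, L 0 w = 0};
  Levy_indep : forall (s t : R) A B, 0 <= s -> s < t -> F s A -> <<s @open U >> B ->
    (P (A `&` increment L s t @^-1` B) = P A * P (increment L s t @^-1` B))%E;
  Levy_stationary : forall (s t : R) B, 0 <= s -> s <= t -> <<s @open U >> B ->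
    P (increment L s t @^-1` B) = P (L (t - s) @^-1` B);
  Levy_stochastic_continuity : forall t eps : R, 0 <= t -> 0 < eps ->
    P [set w | eps < `|L s w - L t w|]
      @[s --> within [set s | 0 <= s] (nbhs t)] --> 0%E
}.

Definition martingale (U : hilbertType R) (F : R -> set (set T)) (L : R -> T -> U) :=
  forall s t : R, 0 <= s -> s <= t -> cond_expectation (F s) (L t) (L s).

(* Covariance operator of a centered square-integrable Levy process. *)
Definition covariance_operator (U : hilbertType R) (L : R -> T -> U) (Q : U -> U) :=
  forall (s t : R) x y, 0 <= s -> 0 <= t ->
    ('E_P[fun w => ('[L s w, x] * '[L t w, y])%R] =
     (Num.min s t * '[Q x, y])%:E)%E.

(* On the times j = 0, 1, ..., the map [S] sends an initial value to the
   process it generates. *)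
Section Stability.
Variables (V : hilbertType R) (F0 : set (set T)) (S : (T -> V) -> nat -> T -> V).

Let msq (X : T -> V) : \bar R := 'E_P[fun w => (`|X w| ^+ 2)%R]%E.

Definition mean_square_stable :=
  forall eps : R, 0 < eps -> exists2 delta : R, 0 < delta &
    forall X0, square_integrable X0 -> rv_wrt F0 X0 ->
      (msq (S X0 0) < delta%:E)%E -> forall j, (msq (S X0 j) < eps%:E)%E.

Definition asymptotically_mean_square_stable :=
  mean_square_stable /\
  exists2 delta : R, 0 < delta &
    forall X0, square_integrable X0 -> rv_wrt F0 X0 ->
      (msq (S X0 0) < delta%:E)%E -> msq (S X0 j) @[j --> \oo] --> 0%E.

End Stability.

End Probability.

Section RationalApproximation.
Context {R : realType}.

Definition cexp (z : R[i]) : R[i] :=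
  Complex (expR (complex.Re z) * cos (complex.Im z))
          (expR (complex.Re z) * sin (complex.Im z)).

Definition crat (rn rd : {poly R}) (z : R[i]) : R[i] :=
  (map_poly (real_complex R) rn).[z] / (map_poly (real_complex R) rd).[z].

(* The bound is only asked where the denominator does not vanish, since
   division by zero is a junk value: at a pole of rn / rd that is an
   accumulation point it fails anyway, and at a common zero of [rn] and [rd]
   there is nothing to ask. *)
Definition rational_approx_exp (rn rd : {poly R}) (p : nat) :=
  rd != 0 /\
  exists c delta : R, [/\ 0 < c, 0 < delta &
    forall z : R[i], ComplexField.Normc.normc z < delta ->
      (map_poly (real_complex R) rd).[z] != 0 ->
      ComplexField.Normc.normc (crat rn rd z - cexp z)
        <= c * ComplexField.Normc.normc z ^+ p.+1].

End RationalApproximation.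

Section Scheme.
Context {R : realType} {H U V : hilbertType R}.
Variables (iota : V -> H) (Ph : H -> V) (n : nat) (lam : 'I_n -> R) (e : 'I_n -> V).
Variables (rn rd : {poly R}) (dt : R) (F : H -> H) (G : H -> U -> H).

(* R(dt A_h) *)
Definition rat_op (v : V) : V :=
  \sum_k (rn.[- dt * lam k] / rd.[- dt * lam k] * '[v, e k]) *: e k.

(* rd^-1(dt A_h) *)
Definition rdinv_op (v : V) : V :=
  \sum_k (rd.[- dt * lam k]^-1 * '[v, e k]) *: e k.

Definition Ddet (v : V) : V := rat_op v + rdinv_op (dt *: Ph (F (iota v))).

Definition Cop (u : U) (v : V) : V := rdinv_op (Ph (G (iota v) u)).

Fixpoint galerkin_EM (T : Type) (L : R -> T -> U) (Xh0 : T -> V) (j : nat)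
    : T -> V :=
  if j is i.+1 then fun w =>
    let X := galerkin_EM L Xh0 i w in
    let dL := L (i.+1%:R * dt) w - L (i%:R * dt) w in
    Ddet X + rdinv_op (Ph (G (iota X) dL))
  else Xh0.

End Scheme.

(* [iota] identifies the abstract space [V] with a subspace of [H] that carries
   the inner product of [H]. *)
Definition isometric_embedding (R : realType) (V H : hilbertType R) (iota : V -> H) :=
  forall v w, '[iota v, iota w] = '[v, w].

Definition orthogonal_projection (R : realType) (V H : hilbertType R)
    (iota : V -> H) (Ph : H -> V) :=
  forall x w, '[x - iota (Ph x), iota w] = 0.

(* Main.v *)
(** Let x_a = <X_h^j, e_a> be the coordinates of the scheme.  By the Riesz
    representation, x_a^(j+1) = sum_i Z_ai x_i^j with
    Z_ai = <D e_i, e_a> + <dL^j, g_ai>, where <u, g_ai> = <(C u) e_i, e_a>.  The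
    increment dL^j is centered, has covariance dt Q and is independent of F_(t_j);
    hence E[Z_ai Z_bl] is the matrix entry of S from e_i (x) e_l to e_a (x) e_b, and
    the second moments E[X^j (x) Y^j] of two solutions evolve by iterating S.

    If S^j -> 0, then E|X^j|^2 <= c_j E|X^0|^2 with c_j -> 0.  Conversely, for
    deterministic initial values the mixed moments of two solutions are dominated by
    their second moments, so stability forces S^j (e_i (x) e_l) -> 0.  Finally
    S^j -> 0 is equivalent to rho(S) < 1: the factors of the characteristic
    polynomial in Cayley-Hamilton are removed one by one, using that
    u_(k+1) - z u_k -> 0 with |z| < 1 implies u_k -> 0. *)

Require Import Defs.
From HB Require Import structures.
From mathcomp Require Import all_boot all_order all_algebra complex.
From mathcomp Require Import all_classical all_reals all_analysis.
From mathcomp Require Import measurable_realfun.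
From mathcomp Require Import ring lra.

Set Implicit Arguments.
Unset Strict Implicit.
Unset Printing Implicit Defensive.

Import Order.TTheory GRing.Theory Num.Theory.
Import numFieldNormedType.Exports.

Local Open Scope classical_set_scope.
Local Open Scope ring_scope.

(** * Hilbert spaces *)

Section Inner.
Context {R : realType} {H : hilbertType R}.
Implicit Types x y z : H.

Lemma innerDl x y z : '[x + y, z] = '[x, z] + '[y, z].
Proof. by rewrite -{1}(scale1r x) inner_linearl mul1r. Qed.

Lemma inner0l z : '[0, z] = 0 :> R.
Proof.
by have /eqP := innerDl 0 0 z; rewrite addr0 addrC -subr_eq subrr => /eqP.
Qed.

Lemma innerZl a x z : '[a *: x, z] = a * '[x, z].
Proof. by rewrite -(addr0 (a *: x)) inner_linearl inner0l addr0. Qed.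

Lemma innerNl x z : '[- x, z] = - '[x, z].
Proof. by rewrite -scaleN1r innerZl mulN1r. Qed.

Lemma innerBl x y z : '[x - y, z] = '[x, z] - '[y, z].
Proof. by rewrite innerDl innerNl. Qed.

Lemma innerZr a x z : '[z, a *: x] = a * '[z, x].
Proof. by rewrite innerC innerZl (innerC x). Qed.

Lemma inner0r z : '[z, 0] = 0 :> R.
Proof. by rewrite innerC inner0l. Qed.

Lemma innerBr x y z : '[z, x - y] = '[z, x] - '[z, y].
Proof. by rewrite innerC innerBl !(innerC z). Qed.

Lemma inner_suml I (r : seq I) (p : pred I) (F : I -> H) z :
  '[\sum_(i <- r | p i) F i, z] = \sum_(i <- r | p i) '[F i, z].
Proof.
by apply: (big_morph (fun x => '[x, z])) => [? ?|]; rewrite ?innerDl ?inner0l.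
Qed.

Lemma inner_sumr I (r : seq I) (p : pred I) (F : I -> H) z :
  '[z, \sum_(i <- r | p i) F i] = \sum_(i <- r | p i) '[z, F i].
Proof. by rewrite innerC inner_suml; apply: eq_bigr => i _; rewrite innerC. Qed.

Lemma Cauchy_Schwarz x y : `|'[x, y]| <= `|x| * `|y|.
Proof.
have [->|y0] := eqVneq y 0; first by rewrite inner0r !normr0 mulr0.
have ny : 0 < `|y| by rewrite normr_gt0.
(* The square expands to [|y|^2 (|x|^2 |y|^2 - <x, y>^2)], and [|y|^2] is positive. *)
have := sqr_ge0 (`| (`|y| ^+ 2) *: x - '[x, y] *: y|).
rewrite -inner_norm innerBl !innerBr !innerZl !innerZr !inner_norm (innerC y x) => h.
rewrite -(ler_pXn2r (n:=2)) ?nnegrE ?mulr_ge0// real_normK ?num_real//.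
rewrite exprMn -(ler_pM2l (exprn_gt0 2 ny)); nra.
Qed.

Lemma cvg_inner T (F : set_system T) (FF : Filter F) (g : T -> H) l y :
  g t @[t --> F] --> l -> '[g t, y] @[t --> F] --> '[l, y].
Proof.
move=> gl; apply/cvgrPdist_le => eps eps0.
(* The summand 1 keeps the denominator positive when [y = 0]. *)
have c0 : 0 < eps / (`|y| + 1) by rewrite divr_gt0// ltr_wpDl.
move/cvgrPdist_le : gl => /(_ _ c0); apply: filterS => t h.
rewrite -innerBl (le_trans (Cauchy_Schwarz _ _))//.
rewrite (le_trans (ler_wpM2r (normr_ge0 y) h))//.
rewrite mulrAC ler_pdivrMr ?ltr_wpDl// ler_pM2l//; lra.
Qed.

Lemma inner_continuous y : continuous (fun x => '[x, y]).
Proof. by move=> x; apply: cvg_inner; exact: cvg_id. Qed.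

Section FinBasis.
Variables (n : nat) (b : 'I_n -> H).
Hypothesis bP : fin_orthonormal_basis b.

Lemma basisE i j : '[b i, b j] = (i == j)%:R.
Proof. by rewrite bP.1; congr (_%:R); congr nat_of_bool; apply/asboolP/eqP. Qed.

Lemma basis_decomp x : x = \sum_k '[x, b k] *: b k.
Proof. exact: bP.2. Qed.

Lemma basis_inj x y : (forall k, '[x, b k] = '[y, b k]) -> x = y.
Proof.
by move=> h; rewrite (basis_decomp x) (basis_decomp y); apply: eq_bigr => k _; rewrite h.
Qed.

Lemma inner_basis_sum (c : 'I_n -> R) k : '[\sum_i c i *: b i, b k] = c k.
Proof.
rewrite inner_suml (bigD1 k)//= big1 ?addr0; last first.
  by move=> i /negbTE ik; rewrite innerZl basisE ik mulr0.
by rewrite innerZl basisE eqxx mulr1.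
Qed.

Lemma sqr_normE x : `|x| ^+ 2 = \sum_k '[x, b k] ^+ 2.
Proof.
rewrite -inner_norm {2}(basis_decomp x) inner_sumr.
by apply: eq_bigr => k _; rewrite innerZr expr2.
Qed.

Lemma cvg_basis T (F : set_system T) (FF : Filter F) (g : T -> H) l :
  (forall k, '[g t, b k] @[t --> F] --> '[l, b k]) -> g t @[t --> F] --> l.
Proof.
move=> h.
rewrite (_ : (fun t => g t) = fun t => \sum_k '[g t, b k] *: b k); last first.
  by apply/funext => t; exact: basis_decomp.
rewrite [l in X in _ --> X]basis_decomp.
apply: cvg_big => [|k _]; first exact: add_continuous.
by apply: cvgZr_tmp; exact: h.
Qed.

End FinBasis.

End Inner.

Lemma cvg_bounded_linear (R : realType) (V W : normedModType R)
    (phi : {linear V -> W}) (c : R) T (F : set_system T) (FF : Filter F) (g : T -> V) l :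
  (forall x, `|phi x| <= c * `|x|) ->
  g t @[t --> F] --> l -> phi (g t) @[t --> F] --> phi l.
Proof.
move=> phic gl; apply/cvgrPdist_le => eps eps0.
(* As [c] may be zero or negative, [|c| + 1] replaces it as a positive bound. *)
have c0 : 0 < eps / (`|c| + 1) by rewrite divr_gt0// ltr_wpDl.
move/cvgrPdist_le : gl => /(_ _ c0); apply: filterS => t h.
rewrite -linearB (le_trans (phic _))//.
rewrite (@le_trans _ _ ((`|c| + 1) * `|l - g t|))//.
  by rewrite ler_wpM2r// (le_trans (ler_norm c))// lerDl.
by rewrite mulrC -ler_pdivlMr// ltr_wpDl.
Qed.

(** * Parseval series and the Riesz representation *)

Section OrthonormalBasis.
Context {R : realType} {U : hilbertType R}.
Variables (f : nat -> U) (f_basis : orthonormal_basis f).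

Lemma orthonormal_seqE i j : '[f i, f j] = (i == j)%:R.
Proof. by rewrite f_basis.1; congr (_%:R); congr nat_of_bool; apply/asboolP/eqP. Qed.

Lemma inner_orthonormal_sum (a : nat -> R) (r : seq nat) k : uniq r -> k \in r ->
  '[f k, \sum_(j <- r) a j *: f j] = a k.
Proof.
move=> ur kr; rewrite inner_sumr (bigD1_seq k)//= big1 ?addr0.
  by rewrite innerZr orthonormal_seqE eqxx mulr1.
by move=> j jk; rewrite innerZr orthonormal_seqE eq_sym (negbTE jk) mulr0.
Qed.

Lemma sqr_norm_orthonormal_sum (a : nat -> R) (r : seq nat) : uniq r ->
  `|\sum_(k <- r) a k *: f k| ^+ 2 = \sum_(k <- r) a k ^+ 2.
Proof.
move=> ur; rewrite -inner_norm inner_suml big_seq [RHS]big_seq.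
by apply: eq_bigr => k kr; rewrite innerZl inner_orthonormal_sum.
Qed.

Lemma inner_series x y :
  series (fun k => '[x, f k] * '[f k, y]) @ \oo --> '[x, y].
Proof.
rewrite (_ : series _ = fun n => '[series (fun k => '[x, f k] *: f k) n, y]).
  by apply: cvg_inner; exact: f_basis.2.
apply/funext => n; rewrite /series/= inner_suml.
by apply: eq_bigr => k _; rewrite innerZl.
Qed.

Section Riesz.
Variables (phi : {linear U -> R^o}) (c : R).
Hypothesis phi_bounded : forall u, `|phi u| <= c * `|u|.

(** Testing [phi] on [s = sum_k phi(f_k) f_k] gives [|s|^2 = phi s <= c |s|], hence [|s| <= c]. *)
Lemma Bessel (r : seq nat) : uniq r -> \sum_(k <- r) phi (f k) ^+ 2 <= c ^+ 2.
Proof.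
move=> ur; pose s := \sum_(k <- r) phi (f k) *: f k.
have sE : `|s| ^+ 2 = \sum_(k <- r) phi (f k) ^+ 2 by exact: sqr_norm_orthonormal_sum.
have phis : phi s = `|s| ^+ 2.
  by rewrite sE linear_sum; apply: eq_bigr => k _; rewrite linearZ.
have := phi_bounded s; rewrite phis ger0_norm ?sqr_ge0// -sE expr2.
have [->|s0 h] := eqVneq `|s| 0; first by rewrite !mul0r sqr_ge0.
have s1 : 0 < `|s| by rewrite lt_neqAle eq_sym s0/=.
by move: h; rewrite ler_pM2r// => h; rewrite ler_pM// ltW.
Qed.

(** The representing vector is [sum_k phi(f_k) f_k]: both sides are then the limit of the series of
    [<u, f_k> phi(f_k)]. *)
Lemma Riesz_representation : exists g, forall u, phi u = '[u, g].
Proof.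
pose s := series (fun k => phi (f k) *: f k).
have cs : cvgn (series (fun k => phi (f k) ^+ 2)).
  apply: nondecreasing_is_cvgn.
    apply/nondecreasing_seqP => n.
    by rewrite /series/= big_nat_recr//= lerDl sqr_ge0.
  by exists (c ^+ 2) => _ [n _ <-]; rewrite /series/= Bessel// iota_uniq.
(* A block of the vector series has squared norm equal to the same block of the scalar series, so
   the Cauchy criterion transfers, with [eps^2] for [eps]. *)
have {}cs : cvgn s.
  apply/cauchy_cvgP/cauchy_seriesP => eps eps0.
  move/cauchy_cvgP/cauchy_seriesP : cs => /(_ _ (exprn_gt0 2 eps0)).
  apply: filterS => n /=.
  rewrite -sqr_norm_orthonormal_sum ?iota_uniq// ger0_norm ?sqr_ge0//.
  by rewrite ltr_pXn2r ?nnegrE ?(ltW eps0).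
exists (limn s) => u.
have phiE : series (fun k => '[u, f k] * phi (f k)) @ \oo --> phi u.
  rewrite (_ : series _ = fun n => phi (series (fun k => '[u, f k] *: f k) n)).
    by apply: cvg_bounded_linear phi_bounded _; exact: f_basis.2.
  apply/funext => n; rewrite /series/= linear_sum.
  by apply: eq_bigr => k _; rewrite linearZ.
have gE : series (fun k => '[u, f k] * phi (f k)) @ \oo --> '[u, limn s].
  rewrite (_ : series _ = fun n => '[s n, u]); first by rewrite innerC; exact: cvg_inner.
  apply/funext => n; rewrite /s /series/= inner_suml.
  by apply: eq_bigr => k _; rewrite innerZl innerC mulrC.
exact: cvg_unique phiE gE.
Qed.

End Riesz.

End OrthonormalBasis.

(** If [y != 0], some [x] in [D] has [|y - x| < |y|], whereas orthogonality gives
    [|y - x|^2 = |y|^2 + |x|^2]. *)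
Lemma orthogonal_dense_eq0 (R : realType) (H : hilbertType R) (D : set H) y :
  dense D -> (forall x, D x -> '[y, x] = 0) -> y = 0.
Proof.
move=> dD yD; apply/eqP; apply: contrapT => /negP y0.
have ny : 0 < `|y| by rewrite normr_gt0.
have ob : open (ball y `|y|) by exact: ball_open.
have [|x [bx Dx]] := dD _ _ ob.
  by exists y; exact: ballxx.
move: bx; rewrite -ball_normE /ball_/= ltNge => /negP; apply.
rewrite -(ler_pXn2r (n:=2)) ?nnegrE// -!inner_norm innerBl !innerBr (innerC x y).
by rewrite (yD _ Dx) !inner_norm; have := sqr_ge0 `|x|; lra.
Qed.

(** * The product basis of the tensor square *)

Section TensorBasis.
Context {R : realType} {V V2 : hilbertType R}.
Variables (t : {bilinear V -> V -> V2}) (t_tensor : hilbert_tensor t).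
Variables (n : nat) (e : 'I_n -> V) (e_basis : fin_orthonormal_basis e).

(** Pairs of indices are enumerated because [fin_orthonormal_basis] expects an ordinal index. *)
Definition tensor_basis (k : 'I_#|{: 'I_n * 'I_n}|) : V2 :=
  t (e (enum_val k).1) (e (enum_val k).2).

Lemma tensor_decomp v w :
  t v w = \sum_(p : 'I_n * 'I_n) ('[v, e p.1] * '[w, e p.2]) *: t (e p.1) (e p.2).
Proof.
rewrite [in LHS](basis_decomp e_basis v) [in LHS](basis_decomp e_basis w).
rewrite linear_sumlz -(pair_bigA _ (fun i j => ('[v, e i] * '[w, e j]) *: t (e i) (e j)))/=.
apply: eq_bigr => i _; rewrite linear_sumr; apply: eq_bigr => j _.
by rewrite linearZl_LR linearZr_LR /= scalerA.
Qed.

Lemma big_tensor_basis (F : 'I_n * 'I_n -> V2) :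
  \sum_(k < #|{: 'I_n * 'I_n}|) F (enum_val k) = \sum_p F p.
Proof. by apply/esym/reindex; exact/onW_bij/enum_val_bij. Qed.

Lemma inner_tensor_basis p q :
  '[t (e p.1) (e p.2), t (e q.1) (e q.2)] = (p == q)%:R.
Proof.
rewrite t_tensor.1 !(basisE e_basis); case: p q => [i j] [k l] /=.
by rewrite -natrM mulnb xpair_eqE.
Qed.

(** For completeness, the difference of [x] and its expansion is orthogonal to every [e_i (x) e_j],
    hence by [tensor_decomp] to all sums of simple tensors, which are dense. *)
Lemma tensor_basisP : fin_orthonormal_basis tensor_basis.
Proof.
split=> [k l|x].
  rewrite inner_tensor_basis (inj_eq enum_val_inj).
  by congr (_%:R); congr nat_of_bool; apply/eqP/asboolP.
rewrite /tensor_basis.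
rewrite (big_tensor_basis (fun p => '[x, t (e p.1) (e p.2)] *: t (e p.1) (e p.2))).
apply/eqP; rewrite -subr_eq0; apply/eqP.
apply: (orthogonal_dense_eq0 t_tensor.2) => _ [m [a [b ->]]].
rewrite inner_sumr big1// => i _; rewrite tensor_decomp inner_sumr big1// => p _.
rewrite innerZr innerBl inner_suml (bigD1 p)//= innerZl inner_tensor_basis eqxx mulr1.
rewrite big1 ?addr0 ?subrr ?mulr0// => q qp.
by rewrite innerZl inner_tensor_basis (negbTE qp) mulr0.
Qed.

Lemma tensor_basis_inj x y :
  (forall i j, '[x, t (e i) (e j)] = '[y, t (e i) (e j)]) -> x = y.
Proof. by move=> h; apply: (basis_inj tensor_basisP) => k; exact: h. Qed.

End TensorBasis.

(** * The covariance operator and the tensor q *)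

Section CovarianceTensor.
Context {R : realType} {U U2 V2 : hilbertType R}.
Variables (tU : {bilinear U -> U -> U2}) (tU_tensor : hilbert_tensor tU).
Variables (f : nat -> U) (f_basis : orthonormal_basis f).
Variables (Q : {linear U -> U}) (Q_selfadjoint : forall x y, '[Q x, y] = '[x, Q y]).
Variables (mu : nat -> R) (Q_eigen : forall k, Q (f k) = mu k *: f k).
Hypothesis mu_ge0 : forall k, 0 <= mu k.
Hypothesis Q_trace_class : cvgn (series (fun k => '[Q (f k), f k])).
Variables (CC : {bilinear U2 -> V2 -> V2}) (CC_bounded : bounded_bilinear CC).

(** Parseval for [Q x] and [y], as self-adjointness gives [<Q x, f_k> = mu_k <x, f_k>]. *)
Lemma inner_eigen_series x y :
  series (fun k => mu k * ('[x, f k] * '[f k, y])) @ \oo --> '[Q x, y].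
Proof.
rewrite (_ : (fun k => _) = fun k => '[Q x, f k] * '[f k, y]).
  exact: inner_series.
by apply/funext => k; rewrite Q_selfadjoint Q_eigen innerZr mulrA.
Qed.

(** The convergence is absolute: [f_k (x) f_k] is a unit vector, so the norms are
    [mu_k = <Q f_k, f_k>], summable by the trace-class condition. Hence the [limn] defining q is a
    genuine limit. *)
Lemma covariance_tensor_cvg :
  cvgn (series (fun k => mu k *: tU (f k) (f k))).
Proof.
have normE : (fun k => '[Q (f k), f k]) = fun k => `|mu k *: tU (f k) (f k)|.
  apply/funext => k; rewrite Q_eigen innerZl normrZ ger0_norm//.
  have f1 : '[f k, f k] = 1 by rewrite (orthonormal_seqE f_basis) eqxx.
  congr (_ * _); rewrite f1; apply/eqP.
  by rewrite eq_sym -(@eqrXn2 _ 2)// expr1n -inner_norm tU_tensor.1 f1 mulr1.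
by apply: normed_cvg; move: Q_trace_class; rewrite normE.
Qed.

(** For fixed [x], boundedness makes [CC] continuous in its first argument, so it passes through the
    sum. *)
Lemma CC_covariance_tensor x y :
  series (fun k => mu k * '[CC (tU (f k) (f k)) x, y]) @ \oo -->
  '[CC (limn (series (fun k => mu k *: tU (f k) (f k)))) x, y].
Proof.
have [c cP] := CC_bounded.
pose s := series (fun k => mu k *: tU (f k) (f k)); rewrite -/s.
rewrite (_ : series _ = fun n => '[applyr CC x (s n), y]).
  apply: cvg_inner; apply: (@cvg_bounded_linear _ _ _ (applyr CC x) (c * `|x|)).
    by move=> u; rewrite mulrAC; exact: cP.
  exact: covariance_tensor_cvg.
apply/funext => n; rewrite /s /series/= linear_sumlz inner_suml.
by apply: eq_bigr => k _; rewrite linearZl_LR innerZl.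
Qed.

End CovarianceTensor.

(** * Spectral radius in finite dimension *)

(** Once the perturbation is small, the recursion gives geometric decay up to a small remainder. *)
Lemma contraction_cvg0 (R : realType) (u eps : nat -> R) (r : R) :
  0 <= r -> r < 1 -> (forall k, 0 <= u k) ->
  (forall k, u k.+1 <= r * u k + eps k) ->
  eps @ \oo --> 0 -> u @ \oo --> 0.
Proof.
move=> r0 r1 u0 rec eps0; apply/cvgr0Pnorm_le => e e0.
(* With this threshold [e / 2] is a fixed point of [x |-> r x + e / 2 (1 - r)], so the remainder
   does not grow. *)
have d0 : 0 < e / 2 * (1 - r) by rewrite mulr_gt0 ?divr_gt0 ?subr_gt0.
move/cvgr0Pnorm_le : eps0 => /(_ _ d0)[N _ epsN].
have bound k : u (N + k)%N <= r ^+ k * u N + e / 2.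
  elim: k => [|k IHk]; first by rewrite addn0 expr0 mul1r lerDl; lra.
  rewrite addnS (le_trans (rec _))//.
  have /ler_normlW := epsN (N + k)%N (leq_addr _ _).
  by rewrite exprS => h; nra.
have : (fun k => r ^+ k * u N) @ \oo --> 0.
  rewrite -[X in _ --> X](mul0r (u N)); apply: cvgMr_tmp.
  by apply: cvg_expr; rewrite ger0_norm.
have e20 : 0 < e / 2 by rewrite divr_gt0.
move=> /cvgr0Pnorm_le /(_ _ e20)[K _ hK].
exists (N + K)%N => // k /= NKk.
have Nk : (N <= k)%N by rewrite (leq_trans _ NKk)// leq_addr.
rewrite ger0_norm// -(subnKC Nk) (le_trans (bound _))//.
have /ler_normlW := hK (k - N)%N ltac:(by rewrite /= leq_subRL).
by lra.
Qed.

(** * Powers of a complex matrix *)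

Section MatrixPowers.
Context {R : realType}.
Local Notation C := (R[i]).
Local Notation normc := (@ComplexField.Normc.normc R).
Import ComplexField.Normc.

Lemma normc_ge0 (z : C) : 0 <= normc z.
Proof. by case: z => a b; exact: sqrtr_ge0. Qed.

(** With [B_k = A M^k], one has [B_(k+1) - z B_k = A (M - z) M^k]. If the right side tends to 0 and
    [|z| < 1], so does [B_k]. The induction on [s] is for all [A], which absorbs the factor
    [M - z]. *)
Lemma cvg_mul_prod_sub n (M : 'M[C]_n.+1) (s : seq C) (A : 'M[C]_n.+1) :
  (forall z, z \in s -> normc z < 1) ->
  (forall i j, normc ((A * \prod_(z <- s) (M - z%:M) * M ^+ k) i j)
     @[k --> \oo] --> 0) ->
  forall i j, normc ((A * M ^+ k) i j) @[k --> \oo] --> 0.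
Proof.
elim: s A => [|z s IHs] A s1 h i j.
  by move: (h i j); under eq_fun do rewrite big_nil mulr1.
have hs : forall i j, normc ((A * (M - z%:M) * M ^+ k) i j) @[k --> \oo] --> 0.
  apply: IHs => [w ws|i' j']; first by rewrite s1// inE ws orbT.
  by move: (h i' j'); under eq_fun do rewrite big_cons mulrA.
apply: (@contraction_cvg0 _ _ (fun k => normc ((A * (M - z%:M) * M ^+ k) i j)) (normc z)) => //.
- exact: normc_ge0.
- by rewrite s1// inE eqxx.
- by move=> k; exact: normc_ge0.
move=> k; rewrite -normcM.
have -> : (A * M ^+ k.+1) i j = z * (A * M ^+ k) i j + (A * (M - z%:M) * M ^+ k) i j.
  have -> : A * M ^+ k.+1 = A * (M - z%:M) * M ^+ k + z *: (A * M ^+ k).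
    rewrite mulrBr mulrBl -mulrA -exprS -[z%:M]scalemx1 -scalerAr mulr1 -scalerAl.
    by rewrite subrK.
  by rewrite mxE [X in _ + X]mxE addrC.
exact: le_normcD.
Qed.

(** The characteristic polynomial splits over the complex numbers, and by Cayley-Hamilton the
    product of its factors at [M] is 0. All factors can then be removed, starting from the zero
    sequence. *)
Lemma cvg_expr_mx n (M : 'M[C]_n.+1) :
  (forall z, eigenvalue M z -> normc z < 1) ->
  forall i j, normc ((M ^+ k) i j) @[k --> \oo] --> 0.
Proof.
move=> ev i j.
have [s sE] := closed_field_poly_normal (char_poly M).
rewrite (eqP (char_poly_monic M)) scale1r in sE.
have s1 z : z \in s -> normc z < 1.
  by move=> zs; apply: ev; rewrite eigenvalue_root_char sE root_prod_XsubC.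
suff h : forall i j, normc ((1 * M ^+ k) i j) @[k --> \oo] --> 0.
  by move: (h i j); under eq_fun do rewrite mul1r.
apply: (cvg_mul_prod_sub s1) => i' j'.
have -> : \prod_(z <- s) (M - z%:M) = 0.
  have := Cayley_Hamilton M; rewrite sE rmorph_prod => h; rewrite -[RHS]h.
  by apply: eq_bigr => z _; rewrite rmorphB/= horner_mx_X horner_mx_C.
under eq_fun do rewrite mulr0 mul0r mxE normc0.
exact: cvg_cst.
Qed.

End MatrixPowers.

(** * The spectrum in coordinates *)

Section SpectralRadius.
Context {R : realType}.
Local Notation C := (R[i]).
Local Notation normc := (@ComplexField.Normc.normc R).
Import ComplexField.Normc.

Lemma not_eigenvalue_unitmx n (M : 'M[C]_n) z :
  ~~ eigenvalue M z = (M - z%:M \in unitmx).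
Proof. by rewrite negbK -row_free_unit -kermx_eq0. Qed.

(** [eigenvalue] is about row vectors; the determinant is invariant under transposition, which
    yields a column eigenvector. *)
Lemma eigenvalue_colP n (M : 'M[C]_n) z :
  eigenvalue M z -> exists2 v : 'cV_n, v != 0 & M *m v = z *: v.
Proof.
move=> ev.
have : \det (M - z%:M)^T == 0.
  by rewrite det_tr -[_ == 0]negbK -unitfE -unitmxE -not_eigenvalue_unitmx negbK.
move=> /det0P[v v0 vM]; exists v^T; first by rewrite trmx_eq0.
apply/eqP; rewrite -subr_eq0 -mul_scalar_mx -mulmxBl -trmx_eq0 trmx_mul trmxK.
exact/eqP.
Qed.

Variables (K : hilbertType R) (n : nat) (b : 'I_n -> K).
Hypothesis bP : fin_orthonormal_basis b.

(** The coordinates of [p.1 + i p.2] in the complexification of [K]. *)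
Definition coord_pair (p : K * K) : 'cV[C]_n :=
  \col_i Complex '[p.1, b i] '[p.2, b i].

Definition of_coord_pair (v : 'cV[C]_n) : K * K :=
  (\sum_i complex.Re (v i 0) *: b i, \sum_i complex.Im (v i 0) *: b i).

Lemma coord_pairK : cancel coord_pair of_coord_pair.
Proof.
move=> [x y]; rewrite /of_coord_pair/=; congr pair; apply: (basis_inj bP) => k;
  by rewrite (inner_basis_sum bP) mxE.
Qed.

Lemma of_coord_pairK : cancel of_coord_pair coord_pair.
Proof.
move=> v; apply/matrixP => i j; rewrite (ord1 j) mxE /= !(inner_basis_sum bP).
by case: (v i 0).
Qed.

Variable S : {linear K -> K}.

Definition op_matrix : 'M[C]_n := \matrix_(i, j) real_complex R '[S (b j), b i].

Lemma inner_op_basis x i : '[S x, b i] = \sum_j '[S (b j), b i] * '[x, b j].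
Proof.
rewrite {1}(basis_decomp bP x) linear_sum inner_suml.
by apply: eq_bigr => j _; rewrite linearZ innerZl mulrC.
Qed.

Lemma coord_pair_op p : coord_pair (S p.1, S p.2) = op_matrix *m coord_pair p.
Proof.
apply/matrixP => i j; rewrite !mxE /= !inner_op_basis.
apply/eqP; rewrite eq_complex /= !raddf_sum /=; apply/andP; split; apply/eqP;
  by apply: eq_bigr => k _; rewrite !mxE /= mul0r ?subr0 ?addr0.
Qed.

Lemma coord_pair_shift z p :
  coord_pair (complexified_shift S z p) = (op_matrix - z%:M) *m coord_pair p.
Proof.
rewrite mulmxBl -coord_pair_op mul_scalar_mx.
apply/matrixP => i j; rewrite !mxE /=; case: z => zr zi /=.
rewrite !(innerBl, innerDl, innerZl).
by congr Complex; ring.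
Qed.

(** In coordinates the shift is multiplication by [op_matrix - z]. It is inverted by the inverse
    matrix, and an eigenvector destroys its injectivity. *)
Lemma spectrumE : spectrum S = [set z | eigenvalue op_matrix z].
Proof.
apply/seteqP; split => z /=; last first.
  move=> /eigenvalue_colP[v v0 Mv] /bij_inj inj.
  have /inj : complexified_shift S z (of_coord_pair v) = complexified_shift S z (0, 0).
    apply: (can_inj coord_pairK); rewrite !coord_pair_shift of_coord_pairK.
    rewrite mulmxBl Mv mul_scalar_mx subrr.
    rewrite (_ : coord_pair _ = 0) ?mulmx0//.
    by apply/matrixP => i j; rewrite !mxE !inner0l.
  move=> /(congr1 coord_pair); rewrite of_coord_pairK => vE.
  move: v0; rewrite vE => /negP; apply; apply/eqP.
  by apply/matrixP => i j; rewrite !mxE !inner0l.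
move=> nbij; apply: contrapT => /negP; rewrite not_eigenvalue_unitmx => Mu.
apply: nbij; exists (fun p => of_coord_pair (invmx (op_matrix - z%:M) *m coord_pair p)).
  by move=> p; rewrite coord_pair_shift mulKmx// coord_pairK.
move=> p; apply: (can_inj coord_pairK).
by rewrite coord_pair_shift of_coord_pairK mulKVmx.
Qed.

Lemma coord_pair_iter k p :
  coord_pair (iter k S p.1, iter k S p.2) = iter k (mulmx op_matrix) (coord_pair p).
Proof.
by elim: k p => [|k IHk] p; [case: p|rewrite [RHS]iterS -IHk -coord_pair_op].
Qed.

End SpectralRadius.

Section SpectralRadiusLt1.
Context {R : realType}.
Local Notation C := (R[i]).
Local Notation normc := (@ComplexField.Normc.normc R).
Import ComplexField.Normc.
Variables (K : hilbertType R) (S : {linear K -> K}).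

(** Started at an eigenvector [v], the iterates have i-th complex coordinate [z^k v_i]. If
    [|z| >= 1], its modulus stays at least [|v_i| > 0], although it must tend to 0. *)
Lemma cvg_iter_eigenvalue n (b : 'I_n -> K) (bP : fin_orthonormal_basis b) :
  (forall x, iter k S x @[k --> \oo] --> 0) ->
  forall z, eigenvalue (op_matrix b S) z -> normc z < 1.
Proof.
move=> cvgS z /eigenvalue_colP[v v0 Mv].
have [i vi0] : exists i, v i 0 != 0.
  apply: contrapT => /forallNP h; move: v0 => /negP; apply; apply/eqP/matrixP => i j.
  by rewrite (ord1 j) mxE; apply/eqP/negPn/negP; exact: h.
pose p := of_coord_pair b v.
have vk k : Complex '[iter k S p.1, b i] '[iter k S p.2, b i] = z ^+ k * v i 0.
  have := coord_pair_iter bP S k p; rewrite (of_coord_pairK bP).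
  have -> : iter k (mulmx (op_matrix b S)) v = z ^+ k *: v.
    elim: k => [|k IHk]; first by rewrite expr0 scale1r.
    by rewrite iterS IHk -scalemxAr Mv scalerA -exprSr.
  by move=> /matrixP/(_ i 0); rewrite !mxE.
rewrite ltNge; apply/negP => z1.
have nv0 : 0 < normc (v i 0).
  rewrite lt_neqAle normc_ge0 andbT eq_sym; apply/eqP => /eq0_normc.
  exact/eqP.
have hp q : '[iter k S q, b i] @[k --> \oo] --> 0.
  by rewrite -(inner0l (b i)); exact: cvg_inner.
(* Real and imaginary parts both below half of [|v_i|] force a modulus below [|v_i|]. *)
have nv2 : 0 < normc (v i 0) / 2 by rewrite divr_gt0.
have /cvgr0Pnorm_lt /(_ _ nv2) h1 := hp p.1.
have /cvgr0Pnorm_lt /(_ _ nv2) h2 := hp p.2.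
have [N _ /(_ N (leqnn N)) [hx hy]] := filterI h1 h2.
have : normc (v i 0) <= normc (z ^+ N * v i 0).
  rewrite normcM ler_peMl ?normc_ge0//.
  elim: (N) => [|k IHk]; first by rewrite expr0 normc1.
  by rewrite exprS normcM mulr_ege1.
rewrite -vk leNgt => /negP; apply.
rewrite -[ltLHS]ger0_norm ?normc_ge0// -(ltr_pXn2r (n:=2)) ?nnegrE ?normc_ge0//.
rewrite real_normK ?num_real// sqr_sqrtr ?addr_ge0 ?sqr_ge0//.
move: hx hy; rewrite /= !ltr_norml => /andP[? ?] /andP[? ?]; nra.
Qed.

(** Each coordinate of [S^k x] is a fixed combination of entries of the k-th matrix power. The
    dimension is a successor so that square matrices form a ring with powers. *)
Lemma eigenvalue_cvg_iter n (b : 'I_n.+1 -> K) (bP : fin_orthonormal_basis b) :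
  (forall z, eigenvalue (op_matrix b S) z -> normc z < 1) ->
  forall x, iter k S x @[k --> \oo] --> 0.
Proof.
move=> ev x; apply: (cvg_basis bP) => i; rewrite inner0l.
have h := cvg_expr_mx ev.
have xk k : real_complex R '[iter k S x, b i] =
    \sum_j ((op_matrix b S) ^+ k) i j * real_complex R '[x, b j].
  have := coord_pair_iter bP S k (x, 0).
  have -> : iter k (mulmx (op_matrix b S)) (coord_pair b (x, 0)) =
      (op_matrix b S) ^+ k *m coord_pair b (x, 0).
    elim: k => [|k IHk]; first by rewrite expr0 mul1mx.
    by rewrite iterS IHk mulmxA exprS.
  move=> /matrixP/(_ i 0); rewrite !mxE/=.
  have -> : iter k S 0 = 0.
    by elim: k => [//|k IHk]; rewrite iterS IHk linear0.
  rewrite inner0l => xkE; rewrite [LHS]xkE; apply: eq_bigr => j _.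
  by rewrite !mxE/= inner0l.
apply/norm_cvg0P.
apply: (@squeeze_cvgr _ _ _ _ (fun=> 0)
  (fun k => \sum_j normc (((op_matrix b S) ^+ k) i j) * `|'[x, b j]|)).
- near=> k; rewrite normr_ge0/=.
  have -> : `|'[iter k S x, b i]| = normc (real_complex R '[iter k S x, b i]).
    by rewrite /= expr0n/= addr0 sqrtr_sqr.
  rewrite xk.
  have -> : \sum_j normc ((op_matrix b S ^+ k) i j) * `|'[x, b j]| =
     \sum_j normc ((op_matrix b S ^+ k) i j * real_complex R '[x, b j]).
    apply: eq_bigr => j _; rewrite normcM; congr (_ * _).
    by rewrite /= expr0n/= addr0 sqrtr_sqr.
  elim/big_ind2 : _ => //; first by rewrite normc0.
  by move=> u1 u2 v1 v2 h1 h2; rewrite (le_trans (le_normcD _ _))// lerD.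
- exact: cvg_cst.
- rewrite [X in _ --> X](_ : 0 = \sum_(j < n.+1) 0 * `|'[x, b j]|); last first.
    by rewrite big1// => j _; rewrite mul0r.
  apply: cvg_big => [|j _]; first exact: add_continuous.
  by apply: cvgMr_tmp; exact: h.
Unshelve. all: by end_near. Qed.

(** The spectrum is the finite root set of the characteristic polynomial. Hence the supremum is
    bounded by a finite maximum, for which strict inequality is preserved. *)
Lemma spectral_radius_lt1 n (b : 'I_n -> K) (bP : fin_orthonormal_basis b) :
  spectral_radius S < 1 <->
  forall z, eigenvalue (op_matrix b S) z -> normc z < 1.
Proof.
have [s sE] := closed_field_poly_normal (char_poly (op_matrix b S)).
rewrite (eqP (char_poly_monic _)) scale1r in sE.
have evE z : eigenvalue (op_matrix b S) z = (z \in s).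
  by rewrite eigenvalue_root_char sE root_prod_XsubC.
rewrite /spectral_radius (spectrumE bP).
set A := [set _ | _ in _].
pose r := \big[Num.max/0]_(z <- s) normc z.
have Ar : ubound A r.
  by move=> _ [z + <-]; rewrite /= evE => zs; exact: le_bigmax_seq.
split=> [s1 z ev|ev1].
  by rewrite (le_lt_trans _ s1)// ub_le_sup//; [exists r|exists z].
have r1 : r < 1.
  by rewrite /r big_seq; apply: bigmax_lt => // z zs; rewrite ev1// evE.
(* For an empty spectrum, the case of dimension 0, the supremum takes its default value 0. *)
have [->|/set0P A0] := eqVneq A set0; first by rewrite sup0.
by rewrite (le_lt_trans _ r1)// ge_sup.
Qed.

Lemma spectral_radius_lt1P n (b : 'I_n -> K) (bP : fin_orthonormal_basis b) :
  spectral_radius S < 1 <-> forall x, iter k S x @[k --> \oo] --> 0.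
Proof.
rewrite (spectral_radius_lt1 bP); split; last exact: cvg_iter_eigenvalue.
case: n b bP => [b bP _ x|n b bP]; last exact: eigenvalue_cvg_iter.
have x0 (y : K) : y = 0 by rewrite (basis_decomp bP y) big_ord0.
by under eq_fun do rewrite [iter _ _ _]x0; exact: cvg_cst.
Qed.

End SpectralRadiusLt1.

(** * Second moments and independence *)

Section Mean.
Context {R : realType} {d : measure_display} {T : measurableType d}.
Variable P : probability T R.
Implicit Types X Y : T -> R.

Definition mean X : R := (\int[P]_w X w)%R.

Lemma expectation_mean X : X \in Lfun P 1 -> 'E_P[X]%E = (mean X)%:E.
Proof. by move=> X1; rewrite -[LHS]fineK ?expectation_fin_num// unlock. Qed.

Lemma meanE X : mean X = fine 'E_P[X]%E.
Proof. by rewrite unlock. Qed.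

Lemma Lfun_measurable p X : X \in Lfun P p -> measurable_fun setT X.
Proof. by rewrite inE => /andP[]; rewrite inE. Qed.

Lemma meanD X Y : X \in Lfun P 1 -> Y \in Lfun P 1 ->
  mean (fun w => X w + Y w) = mean X + mean Y.
Proof. by move=> /Lfun1_integrable X1 /Lfun1_integrable Y1; rewrite /mean RintegralD. Qed.

Lemma meanZ X a : X \in Lfun P 1 -> mean (fun w => a * X w) = a * mean X.
Proof. by move=> /Lfun1_integrable X1; rewrite /mean RintegralZl. Qed.

Lemma mean_cst a : mean (fun=> a) = a.
Proof. by rewrite meanE (expectation_cst P a). Qed.

Lemma LfunD p X Y : (1 <= p)%E -> X \in Lfun P p -> Y \in Lfun P p ->
  (fun w => X w + Y w) \in Lfun P p.
Proof. by move=> p1 Xp Yp; rewrite (rpredD Xp Yp). Qed.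

Lemma LfunZ p X a : 1 <= p -> X \in Lfun P p%:E ->
  (fun w => a * X w) \in Lfun P p%:E.
Proof.
move=> p1 /(Lfun_scale a p1); rewrite (_ : _ \o* _ = fun w => a * X w)//.
by apply/funext => w /=; rewrite mulrC.
Qed.

Lemma Lfun_csta p a : (fun=> a) \in Lfun P p%:E.
Proof. exact: (Lfun_cst P a). Qed.

Lemma Lfun21 X : X \in Lfun P 2%:E -> X \in Lfun P 1.
Proof. exact: (Lfun_subset12 (fin_num_measure P _ measurableT)). Qed.

Lemma Lfun_sum (I : Type) (r : seq I) p (F : I -> T -> R) : (1 <= p)%E ->
  (forall i, F i \in Lfun P p) -> (fun w => \sum_(i <- r) F i w) \in Lfun P p.
Proof.
move=> p1 FL; elim: r => [|i r IHr].
  rewrite (_ : (fun _ => _) = 0) ?rpred0//; apply/funext => w; exact: big_nil.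
rewrite (_ : (fun _ => _) = fun w => F i w + \sum_(j <- r) F j w); last first.
  by apply/funext => w; rewrite big_cons.
exact: LfunD.
Qed.

Lemma mean_sum (I : Type) (r : seq I) (F : I -> T -> R) :
  (forall i, F i \in Lfun P 1) ->
  mean (fun w => \sum_(i <- r) F i w) = \sum_(i <- r) mean (F i).
Proof.
move=> FL; elim: r => [|i r IHr].
  rewrite big_nil (_ : (fun _ => _) = fun=> 0) ?mean_cst//.
  by apply/funext => w; exact: big_nil.
rewrite big_cons -IHr -meanD//; last exact: Lfun_sum.
by congr mean; apply/funext => w; rewrite big_cons.
Qed.

Lemma sqr_integrable_Lfun2 X : measurable_fun setT X ->
  ('E_P[fun w => (X w ^+ 2)%R] < +oo)%E -> X \in Lfun P 2%:E.
Proof.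
move=> mX; rewrite unlock => X2.
rewrite inE; apply/andP; split; rewrite inE//= /finite_norm unlock poweR_lty//=.
by under eq_integral do rewrite powR_mulrn// real_normK ?num_real//.
Qed.

(** Independence makes the law of [(X, Y)] the product of the two laws; Tonelli then gives
    integrability of the product and Fubini its mean. *)
Lemma integral_independent (X Y : T -> R) :
  (forall A B, measurable A -> measurable B ->
    P (X @^-1` A `&` Y @^-1` B) = (P (X @^-1` A) * P (Y @^-1` B))%E) ->
  X \in Lfun P 1 -> Y \in Lfun P 1 ->
  (fun w => X w * Y w) \in Lfun P 1 /\ mean (fun w => X w * Y w) = mean X * mean Y.
Proof.
move=> XY X1 Y1.
have mX := Lfun_measurable X1; have mY := Lfun_measurable Y1.
have /Lfun1_integrable iX := X1; have /Lfun1_integrable iY := Y1.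
pose X' : {RV P >-> R} := mfun_Sub (mem_set mX).
pose Y' : {RV P >-> R} := mfun_Sub (mem_set mY).
pose Z w := (X w, Y w).
have mZ : measurable_fun setT Z by exact: measurable_fun_pair.
pose Z' : {RV P >-> _} := mfun_Sub (mem_set mZ).
pose m1 := distribution P X'; pose m2 := distribution P Y'.
pose f (p : R * R) := (p.1 * p.2)%:E.
have mf : measurable_fun setT f.
  by apply/measurable_EFinP/measurable_funM; [exact: measurable_fst|exact: measurable_snd].
(* The two measures agree on rectangles, which determines a product measure. *)
have lawE A : measurable A -> (m1 \x m2)%E A = distribution P Z' A.
  by move=> mA; exact: product_measure_unique.
have intX (g : R -> \bar R) : measurable_fun setT g -> (forall x, 0 <= g x)%E ->
    (\int[m1]_x g x = \int[P]_w g (X w))%E.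
  by move=> mg g0; exact: (ge0_integral_distribution X').
have intY (g : R -> \bar R) : measurable_fun setT g -> (forall x, 0 <= g x)%E ->
    (\int[m2]_x g x = \int[P]_w g (Y w))%E.
  by move=> mg g0; exact: (ge0_integral_distribution Y').
have mn : measurable_fun setT (fun x : R => `|x|%:E).
  by apply/measurable_EFinP; exact: normr_measurable.
have mid : measurable_fun setT (fun x : R => x%:E) by exact/measurable_EFinP.
have absE : (\int[m1]_x \int[m2]_y `|f (x, y)| =
    (\int[P]_w `|X w|%:E) * (\int[P]_w `|Y w|%:E))%E.
  rewrite -(intX (fun x => `|x|%:E))// -(intY (fun x => `|x|%:E))//.
  rewrite -ge0_integralZr//; last exact: integral_ge0.
  apply: eq_integral => x _; rewrite -ge0_integralZl//.
  by apply: eq_integral => y _; rewrite /f/= normrM EFinM.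
have fin (W : T -> R) : P.-integrable setT (EFin \o W) -> (\int[P]_w `|W w|%:E < +oo)%E.
  by move=> /integrableP[].
have if12 : (m1 \x m2)%E.-integrable setT f.
  apply/integrable12ltyP => //; rewrite absE.
  by rewrite lte_mul_pinfty ?integral_ge0 ?fin// ge0_fin_numE ?integral_ge0 ?fin.
have iXY : P.-integrable setT (EFin \o (fun w => X w * Y w)).
  apply/integrableP; split; first exact/measurable_EFinP/measurable_funM.
  rewrite -[ltLHS](ge0_integral_distribution Z' (f := abse \o f))//; last 2 first.
  - exact: measurableT_comp.
  - by move=> p; exact: abse_ge0.
  rewrite (eq_measure_integral (m1 \x m2)%E); last by move=> A mA _; apply/esym/lawE.
  by case/integrableP : if12.
split; first exact/Lfun1_integrable.
apply: EFin_inj; rewrite EFinM -!expectation_mean//; last exact/Lfun1_integrable.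
rewrite unlock.
rewrite -[LHS](integral_distribution (X := Z') (f := f))//.
rewrite (eq_measure_integral (m1 \x m2)%E); last by move=> A mA _; apply/esym/lawE.
rewrite -integral12_prod_meas1// /fubini_F.
have i2 : m2.-integrable setT (fun y : R => y%:E).
  by apply: (integrable_pushforward (phi := Y')) => //; exact: measurable_funP.
have i1 : m1.-integrable setT (fun y : R => y%:E).
  by apply: (integrable_pushforward (phi := X')) => //; exact: measurable_funP.
rewrite -(integral_distribution (X := X') (f := EFin))//.
rewrite -(integral_distribution (X := Y') (f := EFin))//.
rewrite -[in RHS](fineK (integrable_fin_num _ i2))//.
rewrite -integralZr//; apply: eq_integral => x _.
by rewrite fineK ?(integrable_fin_num _ i2)// -integralZl.
Qed.

End Mean.

(** * Measurability with respect to a sub-sigma-algebra, and one random linear step *)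

Section SubMeasurable.
Context {R : realType} {d : measure_display} {T : measurableType d}.
Variable P : probability T R.
Implicit Types (X Y : T -> R) (G : set (set T)).

Lemma continuous_borel (H : hilbertType R) (phi : H -> R) B :
  continuous phi -> measurable B -> <<s @open H >> (phi @^-1` B).
Proof.
move=> /continuousP cphi mB; rewrite -[_ @^-1` _]setTI.
suff : measurable_fun setT (phi : g_sigma_algebraType (@open H) -> R) by exact.
apply: (measurability _ (RGenOpens.measurableE R)) => _ [_ [a [b ->] <-]].
rewrite setTI; apply: sub_sigma_algebra; apply: cphi; exact: interval_open.
Qed.

(** The sigma-algebra is the one generated by [G], so that closure properties of measurable
    functions apply. It is [G] itself when [G] is a sigma-algebra. *)
Definition sub_measurable G X :=
  measurable_fun setT (X : g_sigma_algebraType G -> R).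

Lemma sub_measurable_preimage G X B : sigma_algebra setT G ->
  sub_measurable G X -> measurable B -> G (X @^-1` B).
Proof.
move=> sG mX mB; rewrite -(sigma_algebra_id sG) -[_ @^-1` _]setTI.
exact: mX.
Qed.

Lemma rv_wrt_sub_measurable (H : hilbertType R) G (X : T -> H) (phi : H -> R) :
  rv_wrt G X -> continuous phi -> sub_measurable G (fun w => phi (X w)).
Proof.
move=> GX cphi _ B mB; rewrite setTI; apply: sub_sigma_algebra.
exact: (GX _ (continuous_borel cphi mB)).
Qed.

Lemma rv_wrt_measurable (H : hilbertType R) (X : T -> H) (phi : H -> R) :
  rv_wrt measurable X -> continuous phi -> measurable_fun setT (fun w => phi (X w)).
Proof. by move=> mX cphi _ B mB; rewrite setTI; exact: (mX _ (continuous_borel cphi mB)). Qed.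

Lemma sub_measurableS G G' X : G `<=` G' ->
  sub_measurable G X -> sub_measurable G' X.
Proof.
move=> GG' mX _ B mB.
exact: (@sub_sigma_algebra2 _ setT G' G GG' _ (mX measurableT B mB)).
Qed.

Lemma sub_measurableM G X Y : sub_measurable G X -> sub_measurable G Y ->
  sub_measurable G (fun w => X w * Y w).
Proof. by move=> GX GY; exact: (measurable_funM (GX : measurable_fun _ _)). Qed.

Lemma sub_measurableD G X Y : sub_measurable G X -> sub_measurable G Y ->
  sub_measurable G (fun w => X w + Y w).
Proof. by move=> GX GY; exact: (measurable_funD (GX : measurable_fun _ _)). Qed.

Lemma sub_measurable_cst G (c : R) : sub_measurable G (fun=> c).
Proof. exact: (@measurable_cst _ _ (g_sigma_algebraType G)). Qed.

Lemma sub_measurable_sum G (I : Type) (r : seq I) (F : I -> T -> R) :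
  (forall i, sub_measurable G (F i)) ->
  sub_measurable G (fun w => \sum_(i <- r) F i w).
Proof.
move=> GF; elim: r => [|i r IHr].
  rewrite (_ : (fun w => _) = fun=> 0); first exact: sub_measurable_cst.
  by apply/funext => w; exact: big_nil.
rewrite (_ : (fun w => _) = fun w => F i w + \sum_(j <- r) F j w).
  exact: sub_measurableD.
by apply/funext => w; exact: big_cons.
Qed.

Lemma continuous_norm_sqr (H : hilbertType R) : continuous (fun x : H => `|x| ^+ 2).
Proof. by move=> x; apply: cvgM; exact: norm_continuous. Qed.

(** By Cauchy-Schwarz, [<X, y>^2] is dominated by [|y|^2 |X|^2]. *)
Lemma square_integrable_Lfun2 (H : hilbertType R) (X : T -> H) y :
  square_integrable P X -> (fun w => '[X w, y]) \in Lfun P 2%:E.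
Proof.
move=> [mX X2].
have mXy : measurable_fun setT (fun w => '[X w, y]).
  by apply: (rv_wrt_measurable (phi := fun x => '[x, y])) => //; exact: inner_continuous.
have mX2 : measurable_fun setT (fun w => `|X w| ^+ 2).
  apply: (rv_wrt_measurable (phi := fun x => `|x| ^+ 2)) => //.
  exact: continuous_norm_sqr.
apply: sqr_integrable_Lfun2 => //.
apply: (@le_lt_trans _ _ 'E_P[fun w => (`|y| ^+ 2 * `|X w| ^+ 2)%R]%E).
  apply: expectation_le => [||w|w|].
  - exact: measurable_funX.
  - exact: measurable_funM.
  - exact: sqr_ge0.
  - by rewrite mulr_ge0 ?sqr_ge0.
  - apply/nearW => w; rewrite -exprMn mulrC -(real_normK (num_real '[X w, y])).
    by rewrite ler_pXn2r ?nnegrE ?mulr_ge0// Cauchy_Schwarz.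
move: X2; rewrite unlock => X2.
under eq_integral do rewrite EFinM.
rewrite ge0_integralZl//; last exact/measurable_EFinP.
by rewrite lte_mul_pinfty ?lee_fin ?sqr_ge0.
Qed.

Lemma mean_eq_law X Y : X \in Lfun P 1 -> Y \in Lfun P 1 ->
  (forall B, measurable B -> P (X @^-1` B) = P (Y @^-1` B)) -> mean P X = mean P Y.
Proof.
move=> X1 Y1 XY; apply: EFin_inj; rewrite -!expectation_mean//.
have mX := Lfun_measurable X1; have mY := Lfun_measurable Y1.
pose X' : {RV P >-> R} := mfun_Sub (mem_set mX).
pose Y' : {RV P >-> R} := mfun_Sub (mem_set mY).
rewrite unlock.
rewrite -(integral_distribution (X := X') (f := EFin))//; last exact/Lfun1_integrable.
rewrite -(integral_distribution (X := Y') (f := EFin))//; last exact/Lfun1_integrable.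
by apply: eq_measure_integral => A mA _; exact: XY.
Qed.

Section MomentStep.
Variables (G : set (set T)) (sG : sigma_algebra setT G).
Variables (n : nat) (Z : 'I_n -> 'I_n -> T -> R).
Hypothesis Z2 : forall a i, Z a i \in Lfun P 2%:E.
Hypothesis Zindep : forall a i b l A B, G A -> measurable B ->
  (P (A `&` (fun w => (Z a i w * Z b l w)%R) @^-1` B) =
   P A * P ((fun w => (Z a i w * Z b l w)%R) @^-1` B))%E.

Definition random_map (x : 'I_n -> T -> R) a w := \sum_i Z a i w * x i w.

Let Zmul a i b l X : sub_measurable G X -> X \in Lfun P 1 ->
  (fun w => (Z a i w * Z b l w) * X w) \in Lfun P 1 /\
  mean P (fun w => (Z a i w * Z b l w) * X w) =
  mean P (fun w => Z a i w * Z b l w) * mean P X.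
Proof.
move=> GX X1.
have ZZ : (fun w => Z a i w * Z b l w) \in Lfun P 1 by exact: Lfun2_mul_Lfun1.
apply: integral_independent => // A B mA mB.
by rewrite setIC muleC Zindep//; exact: sub_measurable_preimage.
Qed.

(** A product of two square-integrable variables need not be square integrable. Here [Z^2] and [x^2]
    are integrable and independent, so their product is integrable. *)
Lemma random_map_Lfun2 (x : 'I_n -> T -> R) :
  (forall i, sub_measurable G (x i)) -> (forall i, x i \in Lfun P 2%:E) ->
  forall a, random_map x a \in Lfun P 2%:E.
Proof.
move=> Gx x2 a; apply: Lfun_sum => [|i]; first by rewrite lee1n.
apply: sqr_integrable_Lfun2.
  by apply: measurable_funM; apply: Lfun_measurable.
have xx : (fun w => x i w * x i w) \in Lfun P 1 by exact: Lfun2_mul_Lfun1.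
have Gxx : sub_measurable G (fun w => x i w * x i w) by exact: sub_measurableM.
have [/Lfun1_integrable h _] := Zmul a i a i Gxx xx.
rewrite unlock.
rewrite (_ : (fun w => _) = EFin \o (fun w => Z a i w * Z a i w * (x i w * x i w))).
  exact: (integrable_lty measurableT h).
by apply/funext => w /=; congr EFin; ring.
Qed.

(** After expansion, independence splits each [E[Z_ai Z_bl x_i y_l]] into two factors. *)
Lemma random_map_moment (x y : 'I_n -> T -> R) a b :
  (forall i, sub_measurable G (x i)) -> (forall i, x i \in Lfun P 2%:E) ->
  (forall i, sub_measurable G (y i)) -> (forall i, y i \in Lfun P 2%:E) ->
  mean P (fun w => random_map x a w * random_map y b w) =
  \sum_i \sum_l mean P (fun w => Z a i w * Z b l w) * mean P (fun w => x i w * y l w).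
Proof.
move=> Gx x2 Gy y2.
have xy i l : (fun w => x i w * y l w) \in Lfun P 1 by exact: Lfun2_mul_Lfun1.
have Gxy i l : sub_measurable G (fun w => x i w * y l w) by exact: sub_measurableM.
have h i l := Zmul a i b l (Gxy i l) (xy i l).
transitivity (\sum_i \sum_l mean P (fun w => Z a i w * Z b l w * (x i w * y l w))).
  transitivity (mean P (fun w => \sum_i \sum_l Z a i w * Z b l w * (x i w * y l w))).
    congr mean; apply/funext => w; rewrite /random_map mulr_suml.
    apply: eq_bigr => i _; rewrite mulr_sumr; apply: eq_bigr => l _; ring.
  rewrite (@mean_sum _ _ _ _ _ _ (fun i w => \sum_l Z a i w * Z b l w * (x i w * y l w))).
    apply: eq_bigr => i _.
    rewrite (@mean_sum _ _ _ _ _ _ (fun l w => Z a i w * Z b l w * (x i w * y l w)))//.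
    by move=> l; exact: (h i l).1.
  by move=> i; apply: Lfun_sum => // l; exact: (h i l).1.
by apply: eq_bigr => i _; apply: eq_bigr => l _; exact: (h i l).2.
Qed.

End MomentStep.

End SubMeasurable.

(** * Increments of the Levy process *)

Section LevyMoments.
Context {R : realType} {d : measure_display} {T : measurableType d}.
Variables (P : probability T R) (Ft : R -> set (set T)).
Hypothesis Ft_usual : filtration_usual P Ft.
Variables (U : hilbertType R) (L : R -> T -> U) (L_Levy : Levy_process P Ft L).
Hypothesis L_L2 : forall t : R, 0 <= t -> square_integrable P (L t).
Variables (Q : U -> U) (Q_cov : covariance_operator P L Q).

Local Notation inc := (increment L).

Lemma Levy_Lfun2 t x : 0 <= t -> (fun w => '[L t w, x]) \in Lfun P 2%:E.
Proof. by move=> /L_L2; exact: square_integrable_Lfun2. Qed.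

Lemma mean_Levy s t x y : 0 <= s -> 0 <= t ->
  mean P (fun w => '[L s w, x] * '[L t w, y]) = Num.min s t * '[Q x, y].
Proof. by move=> s0 t0; rewrite meanE Q_cov. Qed.

Lemma increment_Lfun2 s t x : 0 <= s -> 0 <= t ->
  (fun w => '[inc s t w, x]) \in Lfun P 2%:E.
Proof.
move=> s0 t0.
rewrite (_ : (fun w => _) = fun w => '[L t w, x] + (-1) * '[L s w, x]).
  apply: LfunD; rewrite ?lee1n//; first exact: Levy_Lfun2.
  by apply: LfunZ; rewrite ?ler1n//; exact: Levy_Lfun2.
by apply/funext => w; rewrite innerBl mulN1r.
Qed.

Lemma increment_sub_measurable s t x : 0 <= s -> s <= t ->
  sub_measurable (Ft t) (fun w => '[inc s t w, x]).
Proof.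
move=> s0 st; have t0 := le_trans s0 st.
have mL u : 0 <= u -> u <= t -> sub_measurable (Ft t) (fun w => '[L u w, x]).
  move=> u0 ut; apply: sub_measurableS (filtration_incr Ft_usual u0 ut) _.
  apply: (rv_wrt_sub_measurable (phi := fun z => '[z, x])).
    exact: (Levy_adapted L_Levy).
  exact: inner_continuous.
rewrite (_ : (fun w => _) = fun w => '[L t w, x] + (-1) * '[L s w, x]).
  apply: sub_measurableD; first exact: mL.
  apply: sub_measurableM; last exact: mL.
  exact: sub_measurable_cst.
by apply/funext => w; rewrite innerBl mulN1r.
Qed.

(** Expanding the product leaves the coefficient [t - s - s + s] in front of [<Q x, y>]. *)
Lemma mean_increment_mul s t x y : 0 <= s -> s <= t ->
  mean P (fun w => '[inc s t w, x] * '[inc s t w, y]) = (t - s) * '[Q x, y].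
Proof.
move=> s0 st; have t0 := le_trans s0 st.
have LL u v a b : 0 <= u -> 0 <= v ->
    (fun w => '[L u w, a] * '[L v w, b]) \in Lfun P 1.
  by move=> u0 v0; apply: Lfun2_mul_Lfun1; exact: Levy_Lfun2.
rewrite (_ : (fun w => _) = fun w => ('[L t w, x] * '[L t w, y] +
  -1 * ('[L t w, x] * '[L s w, y])) + (-1 * ('[L s w, x] * '[L t w, y]) +
  '[L s w, x] * '[L s w, y])); last first.
  by apply/funext => w; rewrite !innerBl; ring.
have LLN u v a b : 0 <= u -> 0 <= v ->
    (fun w => -1 * ('[L u w, a] * '[L v w, b])) \in Lfun P 1.
  by move=> u0 v0; apply: LfunZ => //; exact: LL.
rewrite meanD; [|by apply: LfunD => //; [exact: LL|exact: LLN]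
  |by apply: LfunD => //; [exact: LLN|exact: LL]].
rewrite meanD; [|exact: LL|exact: LLN].
rewrite meanD; [|exact: LLN|exact: LL].
rewrite !meanZ; [|exact: LL|exact: LL].
rewrite !mean_Levy// !minxx (min_r st) (min_l st).
by ring.
Qed.

Lemma increment_independent s t (phi : U -> R) A B :
  0 <= s -> s < t -> Ft s A -> continuous phi -> measurable B ->
  P (A `&` (fun w => phi (inc s t w)) @^-1` B) =
  (P A * P ((fun w => phi (inc s t w)) @^-1` B))%E.
Proof.
move=> s0 st FA cphi mB.
exact: (Levy_indep L_Levy s0 st FA (continuous_borel cphi mB)).
Qed.

Lemma mean_increment_stationary s t x : 0 <= s -> s <= t ->
  mean P (fun w => '[inc s t w, x]) = mean P (fun w => '[L (t - s) w, x]).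
Proof.
move=> s0 st; apply: mean_eq_law.
- by apply/Lfun21/increment_Lfun2 => //; exact: le_trans st.
- by apply/Lfun21/Levy_Lfun2; rewrite subr_ge0.
move=> B mB; apply: (Levy_stationary L_Levy s0 st (B := (fun z => '[z, x]) @^-1` B)).
by apply: continuous_borel => //; exact: inner_continuous.
Qed.

(* The covariance gives E[<L(h), x> <L(2h) - L(h), x>] = 0, while independence
   and stationarity of the increments turn this into E[<L(h), x>]^2 = 0. *)
Lemma mean_increment s t x : 0 <= s -> s < t ->
  mean P (fun w => '[inc s t w, x]) = 0.
Proof.
move=> s0 st; rewrite mean_increment_stationary ?(ltW st)//.
have : 0 < t - s by rewrite subr_gt0.
move: (t - s) => h h0; have h0' := ltW h0.
have hh0 : 0 <= h + h by rewrite addr_ge0.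
have hlt : h < h + h by rewrite ltrDl.
have [_ m2] : (fun w => '[L h w, x] * '[inc h (h + h) w, x]) \in Lfun P 1 /\
  mean P (fun w => '[L h w, x] * '[inc h (h + h) w, x]) =
  mean P (fun w => '[L h w, x]) * mean P (fun w => '[inc h (h + h) w, x]).
  apply: integral_independent => [A B mA mB||].
  - apply: (increment_independent (phi := fun z => '[z, x])) => //.
      exact: (Levy_adapted L_Levy h0' (continuous_borel (@inner_continuous _ _ x) mA)).
    exact: inner_continuous.
  - exact/Lfun21/Levy_Lfun2.
  - exact/Lfun21/increment_Lfun2.
have m1 : mean P (fun w => '[L h w, x] * '[inc h (h + h) w, x]) = 0.
  rewrite (_ : (fun w => _) = fun w => '[L h w, x] * '[L (h + h) w, x] +
     -1 * ('[L h w, x] * '[L h w, x])); last first.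
    by apply/funext => w; rewrite innerBl; ring.
  have LL u v : 0 <= u -> 0 <= v ->
      (fun w => '[L u w, x] * '[L v w, x]) \in Lfun P 1.
    by move=> u0 v0; apply: Lfun2_mul_Lfun1; exact: Levy_Lfun2.
  rewrite meanD; [|exact: LL|by apply: LfunZ => //; exact: LL].
  rewrite meanZ; last exact: LL.
  by rewrite !mean_Levy// minxx min_l ?(ltW hlt)// mulN1r subrr.
move: m2; rewrite m1 mean_increment_stationary ?(ltW hlt)// addrK.
by move=> /esym/eqP; rewrite mulf_eq0 orbb => /eqP.
Qed.

End LevyMoments.

(** * Second-moment stability of linear stochastic recursions *)

Lemma iter_linear_sum (R : realType) (V : lmodType R) (S : {linear V -> V}) j
    (I : finType) (c : I -> R) (v : I -> V) :
  iter j S (\sum_i c i *: v i) = \sum_i c i *: iter j S (v i).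
Proof.
elim: j => [//|j IHj]; rewrite iterS IHj linear_sum.
by apply: eq_bigr => i _; rewrite linearZ.
Qed.

(** Pointwise [|x y| <= x^2 + y^2]; the constant is not sharp, but suffices for convergence to 0. *)
Lemma normr_mean_mul (R : realType) d (T : measurableType d) (P : probability T R)
    (X Y : T -> R) : X \in Lfun P 2%:E -> Y \in Lfun P 2%:E ->
  `|mean P (fun w => X w * Y w)| <=
    mean P (fun w => X w * X w) + mean P (fun w => Y w * Y w).
Proof.
move=> X2 Y2.
have XX : (fun w => X w * X w) \in Lfun P 1 by exact: Lfun2_mul_Lfun1.
have YY : (fun w => Y w * Y w) \in Lfun P 1 by exact: Lfun2_mul_Lfun1.
have XY : (fun w => X w * Y w) \in Lfun P 1 by exact: Lfun2_mul_Lfun1.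
rewrite -meanD//.
have XXYY : (fun w => X w * X w + Y w * Y w) \in Lfun P 1 by exact: LfunD.
rewrite ler_norml; apply/andP; split; last first.
  apply: le_Rintegral => //; try exact/Lfun1_integrable.
  by move=> w _; nra.
rewrite -mulN1r -meanZ//; apply: le_Rintegral => //.
- by apply/Lfun1_integrable; apply: LfunZ.
- exact/Lfun1_integrable.
- by move=> w _; nra.
Qed.

Lemma mean_sqr_ge0 (R : realType) d (T : measurableType d) (P : probability T R)
    (X : T -> R) : 0 <= mean P (fun w => X w * X w).
Proof. by apply: Rintegral_ge0 => w _; rewrite -expr2 sqr_ge0. Qed.

Section LinearRecursion.
Context {R : realType} {d : measure_display} {T : measurableType d}.
Variables (P : probability T R) (Ft : R -> set (set T)).
Hypothesis Ft_usual : filtration_usual P Ft.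
Variables (U : hilbertType R) (L : R -> T -> U) (L_Levy : Levy_process P Ft L).
Hypothesis L_L2 : forall t : R, 0 <= t -> square_integrable P (L t).
Variables (Q : U -> U) (Q_cov : covariance_operator P L Q).
Variables (dt : R) (dt_gt0 : 0 < dt).
Variables (V : hilbertType R) (n : nat) (e : 'I_n -> V).
Hypothesis e_basis : fin_orthonormal_basis e.
Variables (D : 'I_n -> 'I_n -> R) (g : 'I_n -> 'I_n -> U).
Variable X : (T -> V) -> nat -> T -> V.

Let t_ (j : nat) : R := j%:R * dt.
(** The random transition matrix of step [j] in the basis [e]. *)
Let Z j a i w : R := D a i + '[increment L (t_ j) (t_ j.+1) w, g a i].

Hypothesis X_0 : forall X0, X X0 0 = X0.
Hypothesis X_S : forall X0 j a w,
  '[X X0 j.+1 w, e a] = \sum_i Z j a i w * '[X X0 j w, e i].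

Variables (V2 : hilbertType R) (tV : {bilinear V -> V -> V2}).
Hypothesis tV_tensor : hilbert_tensor tV.
Variable S : {linear V2 -> V2}.
Hypothesis SE : forall i l a b,
  '[S (tV (e i) (e l)), tV (e a) (e b)] = D a i * D b l + dt * '[Q (g a i), g b l].

Let t_ge0 j : 0 <= t_ j.
Proof. by rewrite mulr_ge0 ?ler0n// ltW. Qed.

Let t_lt j : t_ j < t_ j.+1.
Proof. by rewrite ltr_pM2r// ltr_nat. Qed.

Let t_diff j : t_ j.+1 - t_ j = dt.
Proof. by rewrite /t_ -mulrBl -natrB// subSnn mul1r. Qed.

Let Z_Lfun2 j a i : Z j a i \in Lfun P 2%:E.
Proof.
apply: (@LfunD _ _ _ _ _ (fun=> D a i)
  (fun w => '[increment L (t_ j) (t_ j.+1) w, g a i])); rewrite ?lee1n//.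
  exact: Lfun_csta.
exact: (increment_Lfun2 L_L2).
Qed.

Let Z_sub_measurable j a i : sub_measurable (Ft (t_ j.+1)) (Z j a i).
Proof.
apply: (@sub_measurableD _ _ _ _ (fun=> D a i)
  (fun w => '[increment L (t_ j) (t_ j.+1) w, g a i])).
  exact: sub_measurable_cst.
exact: (increment_sub_measurable Ft_usual L_Levy _ (t_ge0 j) (ltW (t_lt j))).
Qed.

(** The product is a continuous function of a single increment, which is independent of the past. *)
Let Z_independent j a i b l A B : Ft (t_ j) A -> measurable B ->
  (P (A `&` (fun w => (Z j a i w * Z j b l w)%R) @^-1` B) =
   P A * P ((fun w => (Z j a i w * Z j b l w)%R) @^-1` B))%E.
Proof.
move=> FA mB.
apply: (increment_independent L_Levy
  (phi := fun u => (D a i + '[u, g a i]) * (D b l + '[u, g b l]))) => //.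
move=> u; apply: cvgM; apply: cvgD; [exact: cvg_cst|exact: inner_continuous
  |exact: cvg_cst|exact: inner_continuous].
Qed.

(** The cross terms vanish because increments are centered. What remains is the matrix entry of [S]
    prescribed by [SE]. *)
Let mean_ZZ j a i b l :
  mean P (fun w => Z j a i w * Z j b l w) = D a i * D b l + dt * '[Q (g a i), g b l].
Proof.
pose Y a i w : R := '[increment L (t_ j) (t_ j.+1) w, g a i].
have Y2 a' i' : Y a' i' \in Lfun P 2%:E by exact: (increment_Lfun2 L_L2).
have Y1 a' i' := Lfun21 (Y2 a' i').
have YY : (fun w => Y a i w * Y b l w) \in Lfun P 1 by exact: Lfun2_mul_Lfun1.
rewrite (_ : (fun w => _) = fun w => (D a i * D b l + D a i * Y b l w) +
    (D b l * Y a i w + Y a i w * Y b l w)); last first.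
  by apply/funext => w; rewrite /Z -/(Y a i w) -/(Y b l w); ring.
have DY a' i' c : (fun w => c * Y a' i' w) \in Lfun P 1 by exact: LfunZ.
have Y0 a' i' : mean P (Y a' i') = 0 by exact: (mean_increment L_Levy L_L2 Q_cov).
rewrite meanD; [|by apply: LfunD => //; exact: Lfun_csta|exact: LfunD].
rewrite meanD ?mean_cst ?meanZ ?Y0//; last exact: Lfun_csta.
rewrite meanD ?meanZ ?Y0//.
rewrite (mean_increment_mul L_L2 Q_cov) ?t_diff ?(ltW (t_lt _))//.
by rewrite !mulr0 addr0 add0r.
Qed.

Definition admissible (X0 : T -> V) := square_integrable P X0 /\ rv_wrt (Ft 0) X0.

(** Both properties are proved together: square integrability at the next step uses that the current
    state is measurable with respect to the past, of which [Z j] is independent. *)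
Lemma coord_adapted X0 j : admissible X0 ->
  (forall i, sub_measurable (Ft (t_ j)) (fun w => '[X X0 j w, e i])) /\
  (forall i, (fun w => '[X X0 j w, e i]) \in Lfun P 2%:E).
Proof.
move=> [X0_2 X0_F]; elim: j => [|j [GX X2]].
  rewrite X_0 /t_ mul0r; split=> i; last exact: square_integrable_Lfun2.
  exact: (rv_wrt_sub_measurable X0_F (@inner_continuous _ _ (e i))).
have XE i : (fun w => '[X X0 j.+1 w, e i]) =
    random_map (Z j) (fun i w => '[X X0 j w, e i]) i.
  by apply/funext => w; exact: X_S.
split=> i; rewrite XE.
  apply: sub_measurable_sum => l; apply: sub_measurableM => //.
  by apply: sub_measurableS (GX l); apply: (filtration_incr Ft_usual) => //; rewrite ltW.
apply: (random_map_Lfun2 _ _ _ GX) => //.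
  exact: (filtration_sigma Ft_usual).
exact: Z_independent.
Qed.

Definition moment (X0 Y0 : T -> V) j i l : R :=
  mean P (fun w => '[X X0 j w, e i] * '[X Y0 j w, e l]).

(** This is [E[X^j (x) Y^j]], given by its real coordinates instead of a vector-valued integral. *)
Definition moment_tensor X0 Y0 j : V2 :=
  \sum_(p : 'I_n * 'I_n) moment X0 Y0 j p.1 p.2 *: tV (e p.1) (e p.2).

Lemma inner_moment_tensor X0 Y0 j a b :
  '[moment_tensor X0 Y0 j, tV (e a) (e b)] = moment X0 Y0 j a b.
Proof.
rewrite inner_suml (bigD1 (a, b))//= big1 ?addr0.
  by rewrite innerZl (inner_tensor_basis tV_tensor e_basis (a, b) (a, b)) eqxx mulr1.
move=> p pab; rewrite innerZl.
by rewrite (inner_tensor_basis tV_tensor e_basis p (a, b)) (negbTE pab) mulr0.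
Qed.

(** One step multiplies the array of moments by the numbers [E[Z_ai Z_bl]], which are the matrix
    entries of [S]. *)
Lemma moment_tensor_iter X0 Y0 j : admissible X0 -> admissible Y0 ->
  moment_tensor X0 Y0 j = iter j S (moment_tensor X0 Y0 0).
Proof.
move=> aX aY; elim: j => [//|j IHj]; rewrite iterS -IHj.
apply: (tensor_basis_inj tV_tensor e_basis) => a b.
rewrite inner_moment_tensor linear_sum inner_suml.
have [GX X2] := coord_adapted j aX; have [GY Y2] := coord_adapted j aY.
rewrite /moment.
rewrite (_ : (fun w => _) = fun w =>
   random_map (Z j) (fun i w => '[X X0 j w, e i]) a w *
   random_map (Z j) (fun i w => '[X Y0 j w, e i]) b w); last first.
  by apply/funext => w; rewrite !X_S.
rewrite (random_map_moment (filtration_sigma Ft_usual (t_ge0 j)) (Z_Lfun2 j)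
  _ _ _ GX X2 GY Y2); last first.
  exact: Z_independent.
rewrite pair_bigA; apply: eq_bigr => -[i l] _ /=.
by rewrite linearZ innerZl SE mean_ZZ mulrC.
Qed.

Definition msq X0 j : R := \sum_a moment X0 X0 j a a.

Lemma msqE X0 j : admissible X0 ->
  ('E_P[fun w => (`|X X0 j w| ^+ 2)%R] = (msq X0 j)%:E)%E.
Proof.
move=> aX; have [_ X2] := coord_adapted j aX.
have XX a : (fun w => '[X X0 j w, e a] * '[X X0 j w, e a]) \in Lfun P 1.
  exact: Lfun2_mul_Lfun1.
rewrite (_ : (fun w => _) = fun w => \sum_a '[X X0 j w, e a] * '[X X0 j w, e a]).
  rewrite expectation_mean; last exact: Lfun_sum.
  by rewrite (mean_sum _ XX).
apply/funext => w; rewrite (sqr_normE e_basis).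
by apply: eq_bigr => a _; rewrite expr2.
Qed.

Lemma msq_ge0 X0 j : 0 <= msq X0 j.
Proof. by apply: sumr_ge0 => a _; exact: mean_sqr_ge0. Qed.

Lemma moment_diag_le_msq X0 j a : moment X0 X0 j a a <= msq X0 j.
Proof.
by rewrite /msq (bigD1 a)//= lerDl sumr_ge0// => b _; exact: mean_sqr_ge0.
Qed.

Lemma normr_moment_le X0 Y0 j a b : admissible X0 -> admissible Y0 ->
  `|moment X0 Y0 j a b| <= msq X0 j + msq Y0 j.
Proof.
move=> aX aY; have [_ X2] := coord_adapted j aX; have [_ Y2] := coord_adapted j aY.
rewrite (le_trans (normr_mean_mul (X2 a) (Y2 b)))//.
by rewrite lerD//; exact: moment_diag_le_msq.
Qed.

(** An amplification bound for the mean square after [j] steps. The sum over [a] is the functional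
    that reads the mean square off a moment tensor, and 2 bounds an initial mixed moment relative to
    the initial mean square. *)
Definition gain j : R :=
  \sum_(p : 'I_n * 'I_n) 2 * `|\sum_a '[iter j S (tV (e p.1) (e p.2)), tV (e a) (e a)]|.

Lemma msq_le_gain X0 j : admissible X0 -> msq X0 j <= msq X0 0 * gain j.
Proof.
move=> aX; rewrite /msq.
under eq_bigr do rewrite -inner_moment_tensor moment_tensor_iter// iter_linear_sum inner_suml.
rewrite exchange_big /= -/(msq X0 0) mulr_sumr; apply: ler_sum => p _.
under eq_bigr do rewrite innerZl.
rewrite -mulr_sumr (le_trans (ler_norm _))// normrM.
rewrite mulrA ler_wpM2r// mulrC mulr_natl mulr2n.
exact: normr_moment_le.
Qed.

Lemma cvg_gain : (forall x, iter j S x @[j --> \oo] --> 0) -> gain @ \oo --> 0.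
Proof.
move=> cS; rewrite [X in _ --> X](_ : 0 = \sum_(p : 'I_n * 'I_n) 2 * `|\sum_(a < n) (0 : R)|).
  apply: cvg_big => [|p _]; first exact: add_continuous.
  apply: cvgMl_tmp; apply: cvg_norm.
  apply: cvg_big => [|a _]; first exact: add_continuous.
  by rewrite -(inner0l (tV (e a) (e a))); exact: cvg_inner.
by rewrite big1// => p _; rewrite big1// normr0 mulr0.
Qed.

Lemma stable_of_cvg_iter : (forall x, iter j S x @[j --> \oo] --> 0) ->
  asymptotically_mean_square_stable P (Ft 0) X.
Proof.
move=> /cvg_gain cg; split.
  move=> eps eps0.
  have [M [_ hM]] := cvg_seq_bounded (cvgP _ cg).
  (* A convergent sequence is bounded; a strictly positive bound is taken in order to divide by
     it. *)
  pose B := `|M| + 1.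
  have MB : M < B by rewrite /B (le_lt_trans (ler_norm M))// ltrDl.
  have gB j : gain j <= B by rewrite (le_trans (ler_norm _))// (hM _ MB).
  have B0 : 0 < B by rewrite /B ltr_wpDl.
  exists (eps / B) => [|X0 X0_2 X0_F]; first by rewrite divr_gt0.
  have aX : admissible X0 by [].
  rewrite msqE// lte_fin => h j; rewrite msqE// lte_fin.
  rewrite (le_lt_trans (msq_le_gain j aX))//.
  rewrite (@le_lt_trans _ _ (msq X0 0 * B))//; first by rewrite ler_wpM2l ?msq_ge0.
  by rewrite -ltr_pdivlMr.
(* The radius is arbitrary: the bound [msq X0 0 * gain j] tends to 0 for every admissible initial
   value. *)
exists 1 => // X0 X0_2 X0_F _; have aX : admissible X0 by [].
under eq_cvg do rewrite msqE//.
apply: cvg_EFin; first exact: nearW.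
apply: (@squeeze_cvgr _ _ _ _ (fun=> 0) (fun j => msq X0 0 * gain j)).
- by apply: nearW => j; rewrite /= msq_ge0 msq_le_gain.
- exact: cvg_cst.
- by rewrite -[X in _ --> X](mulr0 (msq X0 0)); exact: cvgMl_tmp.
Qed.

Lemma admissible_cst v : admissible (fun=> v).
Proof.
split; last first.
  move=> B _; rewrite (preimage_cst v B).
  have [F0 FC _] := filtration_sigma Ft_usual (lexx 0).
  by case: ifPn => // _; rewrite -setC0 -setTD; exact: FC.
split.
  by move=> B _; rewrite (preimage_cst v B); case: ifPn.
by rewrite (expectation_cst P (`|v| ^+ 2)) ltry.
Qed.

(* Deterministic initial values already detect every tensor: the mixed moment of
   two solutions is dominated by the sum of their second moments, so also the
   non-symmetric tensors are seen. *)
Lemma cvg_iter_of_stable : asymptotically_mean_square_stable P (Ft 0) X ->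
  forall x, iter j S x @[j --> \oo] --> 0.
Proof.
move=> [_ [delta delta0 stable]].
(* The initial value [c e_i] has mean square [c^2 <= c <= delta / 2 < delta]. *)
pose c := Num.min 1 (delta / 2).
have c0 : 0 < c by rewrite lt_min ltr01 divr_gt0.
have c2 : c ^+ 2 < delta.
  have : c <= 1 by rewrite ge_min lexx.
  have : c <= delta / 2 by rewrite ge_min lexx orbT.
  by nra.
pose Xc i : T -> V := fun=> c *: e i.
have msq0 i : msq (Xc i) @ \oo --> 0.
  have [X2 XF] : admissible (Xc i) by exact: admissible_cst.
  have := stable _ X2 XF.
  rewrite X_0 (expectation_cst P (`|c *: e i| ^+ 2)) lte_fin.
  rewrite -inner_norm innerZl innerZr (basisE e_basis) eqxx mulr1 -expr2 => /(_ c2).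
  under eq_cvg do rewrite msqE//.
  by move=> /fine_cvg.
have basis0 p : iter j S (tV (e p.1) (e p.2)) @[j --> \oo] --> 0.
  apply: (cvg_basis (tensor_basisP tV_tensor e_basis)) => k; rewrite inner0l.
  rewrite /tensor_basis; set a := (enum_val k).1; set b := (enum_val k).2.
  (* The solutions started at [c e_(p.1)] and [c e_(p.2)] have initial moment tensor
     [c^2 e_(p.1) (x) e_(p.2)]. *)
  have momE j : '[iter j S (tV (e p.1) (e p.2)), tV (e a) (e b)] =
      (c ^+ 2)^-1 * moment (Xc p.1) (Xc p.2) j a b.
    rewrite -inner_moment_tensor moment_tensor_iter; [|exact: admissible_cst..].
    have -> : moment_tensor (Xc p.1) (Xc p.2) 0 = c ^+ 2 *: tV (e p.1) (e p.2).
      apply: (tensor_basis_inj tV_tensor e_basis) => i l.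
      rewrite inner_moment_tensor /moment !X_0 /Xc /= mean_cst !innerZl.
      by rewrite tV_tensor.1; ring.
    have -> : iter j S (c ^+ 2 *: tV (e p.1) (e p.2)) =
        c ^+ 2 *: iter j S (tV (e p.1) (e p.2)).
      by elim: j => [//|j IHj]; rewrite !iterS IHj linearZ.
    by rewrite innerZl mulKf// expf_neq0// gt_eqF.
  rewrite (funext momE).
  rewrite -[X in _ --> X](mulr0 (c ^+ 2)^-1); apply: cvgMl_tmp.
  apply/norm_cvg0P.
  apply: (@squeeze_cvgr _ _ _ _ (fun=> 0) (fun j => msq (Xc p.1) j + msq (Xc p.2) j)).
  - apply: nearW => j; rewrite normr_ge0/=.
    by apply: normr_moment_le; exact: admissible_cst.
  - exact: cvg_cst.
  - by rewrite -[X in _ --> X](addr0 0); apply: cvgD; exact: msq0.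
move=> x; rewrite (basis_decomp (tensor_basisP tV_tensor e_basis) x).
rewrite (funext (fun j => iter_linear_sum S j (fun k => '[x, tensor_basis tV e k])
  (tensor_basis tV e))).
rewrite [X in _ --> X](_ : 0 = \sum_(k < #|{: 'I_n * 'I_n}|)
    '[x, tensor_basis tV e k] *: (0 : V2)); last first.
  by rewrite big1// => k _; rewrite scaler0.
apply: cvg_big => [|k _]; first exact: add_continuous.
by apply: cvgZl_tmp; exact: basis0.
Qed.

End LinearRecursion.

(** * The Galerkin scheme *)

Section GalerkinCoordinates.
Context {R : realType} {H U V : hilbertType R}.
Variables (iota : {linear V -> H}) (Ph : H -> V).
Hypotheses (iota_isometric : isometric_embedding iota)
  (PhE : orthogonal_projection iota Ph).
Variables (n : nat) (lam : 'I_n -> R) (e : 'I_n -> V).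
Hypothesis e_basis : fin_orthonormal_basis e.
Variables (rn rd : {poly R}) (dt : R).
Variables (F : {linear H -> H}) (G : {bilinear H -> U -> H}).

Local Notation D := (Ddet iota Ph lam e rn rd dt F).
Local Notation C := (Cop iota Ph lam e rd dt G).

Lemma inner_projection x w : '[Ph x, w] = '[x, iota w].
Proof.
by have := PhE x w; rewrite innerBl iota_isometric => /eqP; rewrite subr_eq0 => /eqP.
Qed.

Lemma inner_Cop u v a :
  '[C u v, e a] = rd.[- dt * lam a]^-1 * '[G (iota v) u, iota (e a)].
Proof. by rewrite (inner_basis_sum e_basis) inner_projection. Qed.

Lemma inner_Ddet v a : '[D v, e a] =
  rn.[- dt * lam a] / rd.[- dt * lam a] * '[v, e a] +
  rd.[- dt * lam a]^-1 * (dt * '[F (iota v), iota (e a)]).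
Proof.
by rewrite innerDl !(inner_basis_sum e_basis) innerZl inner_projection.
Qed.

(** Linearity of [D] is obtained coordinatewise: [inner_projection] moves [Ph], given as a bare map,
    onto the test vector, leaving only linear maps of [v]. *)
Lemma inner_Ddet_basis v a : '[D v, e a] = \sum_i '[D (e i), e a] * '[v, e i].
Proof.
rewrite inner_Ddet [in iota v](basis_decomp e_basis v) !linear_sum /= inner_suml.
under [RHS]eq_bigr do rewrite inner_Ddet mulrDl.
rewrite big_split /=; congr (_ + _).
  rewrite (bigD1 a)//= big1 ?addr0 => [|i /negbTE ia].
    by rewrite (basisE e_basis) eqxx mulr1.
  by rewrite (basisE e_basis) ia mulr0 mul0r.
rewrite !mulr_sumr; apply: eq_bigr => i _.
by rewrite !linearZ /= innerZl -!mulrA; congr (_ * (_ * _)); rewrite mulrC.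
Qed.

Lemma inner_Cop_basis u v a : '[C u v, e a] = \sum_i '[C u (e i), e a] * '[v, e i].
Proof.
rewrite inner_Cop [in iota v](basis_decomp e_basis v) linear_sum linear_sumlz inner_suml.
rewrite mulr_sumr; apply: eq_bigr => i _.
by rewrite linearZ linearZl_LR innerZl inner_Cop mulrCA mulrC.
Qed.

(** Each matrix entry of [C u] is a bounded linear functional of [u], so the noise enters the
    recursion only through inner products with fixed vectors. *)
Lemma Cop_representation (f : nat -> U) (f_basis : orthonormal_basis f) :
  bounded_bilinear G ->
  exists g : 'I_n -> 'I_n -> U, forall a i u, '[C u (e i), e a] = '[u, g a i].
Proof.
move=> [c cP].
suff h a i : exists g, forall u, '[C u (e i), e a] = '[u, g].
  by exists (fun a i => projT1 (cid (h a i))) => a i u; exact: (projT2 (cid (h a i))).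
pose phi u : R^o := '[C u (e i), e a].
have phi_linear : linear phi.
  move=> b u v; rewrite /phi !inner_Cop linearPr /= innerDl innerZl mulrDr.
  by rewrite mulrCA.
pose phi' : {linear U -> R^o} := HB.pack phi (GRing.isLinear.Build _ _ _ _ _ phi_linear).
apply: (Riesz_representation f_basis (phi := phi')
  (c := `|rd.[- dt * lam a]^-1| * (c * `|iota (e i)| * `|iota (e a)|))) => u.
rewrite /= /phi inner_Cop normrM -[leRHS]mulrA ler_wpM2l//.
rewrite (le_trans (Cauchy_Schwarz _ _))//.
by rewrite [leRHS]mulrAC ler_wpM2r.
Qed.

End GalerkinCoordinates.

Theorem proposition3p2 (R : realType)
    (* complete filtered probability space *)
    (d : measure_display) (Omega : measurableType d) (P : probability Omega R)
    (Pcomplete : measure_is_complete P)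
    (Ft : R -> set (set Omega)) (Ft_usual : filtration_usual P Ft)
    (H U : hilbertType R) (H_separable : separable H) (U_separable : separable U)
    (* mA is the operator -A, and mA_half is (-A)^(1/2) *)
    (mA mA_half : unbounded_op H)
    (mA_dense : dense (dom mA)) (mA_selfadjoint : selfadjoint mA)
    (mA_posdef : op_posdef mA) (mA_compact_inverse : compact_inverse mA)
    (mA_halfE : is_sqrt_op mA mA_half)
    (F : {linear H -> H}) (F_bounded : continuous F)
    (G : {bilinear H -> U -> H}) (G_bounded : bounded_bilinear G)
    (X0 : Omega -> H) (X0_L2 : square_integrable P X0) (X0_F0 : rv_wrt (Ft 0) X0)
    (* driving noise *)
    (L : R -> Omega -> U) (L_Levy : Levy_process P Ft L)
    (L_L2 : forall t : R, 0 <= t -> square_integrable P (L t))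
    (L_martingale : martingale P Ft L)
    (Q : {linear U -> U}) (Q_bounded : continuous Q)
    (Q_selfadjoint : forall x y, '[Q x, y] = '[x, Q y])
    (Q_psd : forall x, 0 <= '[Q x, x])
    (Q_covariance : covariance_operator P L Q)
    (f : nat -> U) (f_basis : orthonormal_basis f)
    (mu : nat -> R) (Q_eigen : forall k, Q (f k) = mu k *: f k)
    (mu_nonincreasing : forall k, mu k.+1 <= mu k) (mu_ge0 : forall k, 0 <= mu k)
    (Q_trace_class : cvgn (series (fun k => '[Q (f k), f k])))
    (* the finite-dimensional space V_h, as a subspace of the domain of
       (-A)^(1/2), and the operator -A_h on it *)
    (Vh : hilbertType R) (iota : {linear Vh -> H})
    (iota_isometric : isometric_embedding iota)
    (Vh_H1 : forall v, dom mA_half (iota v))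
    (Ph : H -> Vh) (PhE : orthogonal_projection iota Ph)
    (mAh : {linear Vh -> Vh})
    (mAhE : forall v w, '[mAh v, w] = '[mA_half (iota v), mA_half (iota w)])
    (Nh : nat) (lam : 'I_Nh -> R) (e : 'I_Nh -> Vh)
    (e_basis : fin_orthonormal_basis e)
    (e_eigen : forall k, mAh (e k) = lam k *: e k)
    (lam_gt0 : forall k, 0 < lam k)
    (lam_nondecreasing : forall k l : 'I_Nh, (k <= l)%N -> lam k <= lam l)
    (* time step and rational approximation *)
    (dt : R) (dt_gt0 : 0 < dt)
    (rn rd : {poly R}) (p : nat) (r_approx : rational_approx_exp rn rd p)
    (rd_neq0 : forall k, rd.[- dt * lam k] != 0)
    (* U^(2), V_h^(2) and the operators on them *)
    (U2 V2 : hilbertType R)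
    (tU : {bilinear U -> U -> U2}) (tU_tensor : hilbert_tensor tU)
    (tV : {bilinear Vh -> Vh -> V2}) (tV_tensor : hilbert_tensor tV)
    (DD : {linear V2 -> V2}) (DD_bounded : continuous DD)
    (DDE : let D := Ddet iota Ph lam e rn rd dt F in is_tensor_op tV D D DD)
    (CC : {bilinear U2 -> V2 -> V2}) (CC_bounded : bounded_bilinear CC)
    (CCE : let C := Cop iota Ph lam e rd dt G in
       forall u1 u2, is_tensor_op tV (C u1) (C u2) (CC (tU u1 u2))) :
  let q : U2 := limn (series (fun k => mu k *: tU (f k) (f k))) in
  let S : V2 -> V2 := fun x => DD x + dt *: CC q x in
  asymptotically_mean_square_stable P (Ft 0)
    (galerkin_EM iota Ph lam e rn rd dt F G L)
  <-> spectral_radius S < 1.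
Proof.
move=> q S.
have [g gE] := Cop_representation iota_isometric PhE lam e_basis rd dt f_basis G_bounded.
have S_linear : linear S.
  move=> a x y; rewrite /S linearP linearPr /= !scalerDr addrACA.
  by rewrite !scalerA mulrC.
pose S' : {linear V2 -> V2} := HB.pack S (GRing.isLinear.Build _ _ _ _ _ S_linear).
pose D a i := '[Ddet iota Ph lam e rn rd dt F (e i), e a].
(* By the representation through [g], the noise part is the series of
   [mu_k <g_ai, f_k> <f_k, g_bl>], whose sum is [<Q g_ai, g_bl>]. *)
have SE i l a b : '[S' (tV (e i) (e l)), tV (e a) (e b)] =
    D a i * D b l + dt * '[Q (g a i), g b l].
  rewrite innerDl innerZl DDE tV_tensor.1; congr (_ + _ * _).
  have := CC_covariance_tensor tU_tensor f_basis Q_eigen mu_ge0 Q_trace_class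
    CC_bounded (x := tV (e i) (e l)) (y := tV (e a) (e b)).
  rewrite (_ : (fun k => _) = fun k => mu k * ('[g a i, f k] * '[f k, g b l])).
    move/cvg_unique; apply => //.
    exact: (inner_eigen_series f_basis Q_selfadjoint Q_eigen).
  by apply/funext => k; rewrite CCE tV_tensor.1 !gE (innerC (f k) (g a i)).
(* The scheme in coordinates, for an arbitrary initial value in [Vh]. *)
have recursion (Y0 : Omega -> Vh) j a w :
    '[galerkin_EM iota Ph lam e rn rd dt F G L Y0 j.+1 w, e a] =
    \sum_i (D a i + '[increment L (j%:R * dt) (j.+1%:R * dt) w, g a i]) *
      '[galerkin_EM iota Ph lam e rn rd dt F G L Y0 j w, e i].
  rewrite /= innerDl (inner_Ddet_basis iota_isometric PhE lam e_basis).
  rewrite [X in _ + X](inner_Cop_basis iota_isometric PhE lam e_basis rd dt G).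
  rewrite -big_split; apply: eq_bigr => i _ /=.
  by rewrite -mulrDl gE.
rewrite -[spectral_radius S]/(spectral_radius S').
(* The spectral condition becomes convergence to 0 of all iterates of [S], which both stability
   arguments use. *)
rewrite (spectral_radius_lt1P S' (tensor_basisP tV_tensor e_basis)).
split.
  exact: (cvg_iter_of_stable Ft_usual L_Levy L_L2 Q_covariance dt_gt0 e_basis
    (fun=> erefl) recursion tV_tensor SE).
exact: (stable_of_cvg_iter Ft_usual L_Levy L_L2 Q_covariance dt_gt0 e_basis
  (fun=> erefl) recursion tV_tensor SE).
Qed.
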